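(* Assume the explicit $abc$-conjecture (stated in the context). Suppose that integers $n\ge1$, $d>1$, $k\ge4$, $b\ge1$, $y\ge1$, $\ell>1$ with $\gcd(n,d)=1$ and $P(b)\le k$ satisfy $$n(n+d)\cdots(n+(k-1)d)=by^{\ell}.$$ Then $\ell\le7$. Further, $k<e^{13006.2}$ when $\ell=7$.
   Context: For an integer $i>1$, $N(i)=\prod_{p\mid i}p$ is the radical of $i$ (product over primes), $P(i)$ is the greatest prime factor of $i$, and $\omega(i)$ is the number of distinct prime factors of $i$; $N(1)=1$, $P(1)=1$, $\omega(1)=0$. Explicit $abc$-conjecture (Baker), taken as a hypothesis: for all pairwise coprime positive integers $a,b,c$ with $a+b=c$, $$c<\frac65\,N\,\frac{(\log N)^{\omega}}{\omega!},\qquad N=N(abc),\ \omega=\omega(N).$$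
   Formalization: The explicit abc-conjecture as written fails for the triple (a,b,c)=(1,1,2), since (6/5)·2·log 2 ≈ 1.66 < 2; it is therefore assumed only for triples with c>2, which excludes exactly that triple. *)

(* Defs.v *)
From mathcomp Require Import all_boot all_order all_algebra.
From mathcomp Require Import all_classical all_reals all_analysis.

Set Implicit Arguments.
Unset Strict Implicit.
Unset Printing Implicit Defensive.

Import Order.TTheory GRing.Theory Num.Theory.

(* [N(i)]; the empty product gives [N(1) = 1].  The companion function [P(i)]
   (greatest prime factor, with [P(1) = 1]) is MathComp's [max_pdiv]. *)
Definition radical (i : nat) : nat := (\prod_(p <- primes i) p)%N.

Definition omega (i : nat) : nat := size (primes i).

Local Open Scope ring_scope.

(* Baker's explicit abc-conjecture.  The condition [2 < c] discards exactly the
   triple 1 + 1 = 2: there [N = 2] and [omega N = 1], and the bound would read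
   2 < (12 / 5) * ln 2 = 1.66..., so that without this condition the hypothesis
   would be contradictory and everything deduced from it vacuous. *)
Definition explicit_abc (R : realType) : Prop :=
  forall a b c : nat,
    (0 < a)%N -> (0 < b)%N ->
    coprime a b -> coprime a c -> coprime b c ->
    (a + b)%N = c -> (2 < c)%N ->
    let N := radical (a * b * c) in
    let w := omega N in
    c%:R < 6 / 5 * N%:R * (ln (N%:R : R) ^+ w / (w`!)%:R).

(* Main.v *)
From Stdlib Require Import NArith.
Require Import Defs.
From HB Require Import structures.
From mathcomp Require Import all_boot all_order all_algebra.
From mathcomp Require Import all_classical all_reals all_analysis.
From mathcomp Require Import ring lra zify.

Set Implicit Arguments.
Unset Strict Implicit.
Unset Printing Implicit Defensive.

Import Order.TTheory GRing.Theory Num.Theory.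

(** Write T_i = n + i d for the terms and M for the last one, T_(k-1).  The
    equation says that a prime p > k dividing some T_i divides no other term and
    does not divide b, so that p^l divides T_i.  The abc-conjecture must
    contradict this as soon as one such prime exists.

    The existence of such a prime (large_prime_factor) is a Sylvester theorem for
    progressions and does not involve abc.  If all T_i were composed of primes
    p <= k, then by an argument of Erdos the product of the T_i, deprived of one
    term for each p, would divide (k-1)!.  This keeps M below 8 (k-1) or so and
    leaves finitely many progressions when k is small; for k <= 4096 they are
    excluded by chains of primes in the classes modulo d <= 7.  For larger k, primes
    above the square root of M occur at most once, and a Chebyshev bound
    primorial k <= 2^(7k/4) contradicts M >= d (k-1); it beats the trivial 4^k, which
    would just fail for d = 2.  In particular M >= (k+1)^l.

    For abc, note that (log N)^w / w! <= t^(-w) N^t / e for every t > 0.  Taking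
    t = 1/2 turns the conjecture into 4 c^2 < prod_(p | abc) 4 p^3, in which
    every prime contributes separately (abc_square).  It is applied to
      T_f^2 + 3 T_(f+2) T_(f+6) = 4 T_(f+3)^2,
    a relation of degree 2 in four terms: the sizes are about M^2, while only the
    first powers of four terms enter the radical.  The primes above k contribute at
    most a small power of M, because they occur to the l-th power in the terms.
    The primes p <= k dividing one of the four terms are handled by multiplying
    the inequalities over all f: each p hits at most 4 (1 + (k-1)/p) windows, so that
    their total contribution is governed by (k-1)! and primorial k
    (windows_product).  For l >= 8 the comparison with M >= (k+1)^8 is a finite
    computation when k < 128 (window_finite) and an estimate with logarithms beyond
    (window_log_bound); for l = 7 it succeeds when k is large.

    When k is 4 or 5 the four positions do not fit, and the linear relation between
    three terms free of primes between 5 and k suffices, with t = 1; k = 6 reduces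
    to k = 5. *)

(** * Prime exponents in products of terms of a progression *)

Local Open Scope nat_scope.

Definition ap (n d i : nat) : nat := n + i * d.

Definition primorial (k : nat) : nat := \prod_(0 <= p < k.+1 | prime p) p.

Definition primepi (k : nat) : nat := \sum_(0 <= p < k.+1 | prime p) 1.

Lemma prod_primes_logn m k : 0 < m -> (forall p, prime p -> p %| m -> p <= k) ->
  m = \prod_(0 <= p < k.+1 | prime p) p ^ logn p m.
Proof.
move=> m0 smooth.
have -> : \prod_(0 <= p < k.+1 | prime p) p ^ logn p m
        = \prod_(0 <= p < k.+1) p ^ logn p m.
  rewrite big_mkcond; apply: eq_bigr => p _.
  by case: ifP => // np; rewrite lognE np.
rewrite -{1}(partnT m0) (widen_partn _ (leq_maxl m k)).
rewrite (@big_cat_nat _ _ _ k.+1) //=; last by rewrite ltnS leq_maxr.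
rewrite [X in _ * X]big_nat_cond [X in _ * X]big1 ?muln1 //.
move=> p /andP[/andP[kp _] _]; rewrite lognE.
case: ifP => // /and3P[pp _ pm].
by have := smooth _ pp pm; rewrite leqNgt kp.
Qed.

Lemma prime_dvd_prod_nat p a b (P : pred nat) (F : nat -> nat) : prime p ->
  p %| \prod_(a <= i < b | P i) F i ->
  exists i, [/\ a <= i, i < b, P i & p %| F i].
Proof.
move=> pp; rewrite Euclid_dvd_prod // big_has_cond => /hasP[i].
by rewrite mem_index_iota => /andP[ai ib] /andP[Pi pi]; exists i.
Qed.

Section AP.
Variables (n d : nat).
Hypotheses (n0 : 0 < n) (nd : coprime n d).

Lemma ap_gt0 i : 0 < ap n d i.
Proof. by rewrite /ap addn_gt0 n0. Qed.

Lemma coprime_ap i : coprime (ap n d i) d.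
Proof. by rewrite /ap /coprime addnC gcdnC gcdnMDl gcdnC. Qed.

Lemma ap_ndvd p i : prime p -> p %| ap n d i -> ~~ (p %| d).
Proof.
move=> pp pT; apply/negP => pd.
have := dvdn_gcd p (ap n d i) d; rewrite pT pd (eqP (coprime_ap i)) dvdn1.
by move/eqP=> p1; rewrite p1 in pp.
Qed.

Lemma dvdn_ap_sub q i j : i <= j -> coprime q d ->
  q %| ap n d i -> q %| ap n d j -> q %| j - i.
Proof.
move=> ij cq qi qj; have := dvdn_sub qj qi.
have -> : ap n d j - ap n d i = (j - i) * d by rewrite /ap subnDl mulnBl.
by rewrite Gauss_dvdl.
Qed.

Lemma logn_ap_sub p i j : prime p -> i < j ->
  minn (logn p (ap n d i)) (logn p (ap n d j)) <= logn p (j - i).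
Proof.
move=> pp ij; set v := minn _ _.
have di : p ^ v %| ap n d i.
  by apply: dvdn_trans (dvdn_exp2l p (geq_minl _ _)) (pfactor_dvdnn _ _).
have dj : p ^ v %| ap n d j.
  by apply: dvdn_trans (dvdn_exp2l p (geq_minr _ _)) (pfactor_dvdnn _ _).
have [-> //|v0] := posnP v.
rewrite -pfactor_dvdn ?subn_gt0 //; apply: dvdn_ap_sub => //; first exact: ltnW.
rewrite coprime_pexpl // prime_coprime //; apply: ap_ndvd (pp) _.
by apply: dvdn_trans di; rewrite dvdn_exp.
Qed.

Lemma prod_subn_fact a : \prod_(0 <= i < a) (a - i) = a`!.
Proof.
rewrite fact_prod big_add1 /= big_nat_rev /= add0n.
by apply: eq_big_nat => i /andP[_ ai]; rewrite subKn.
Qed.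

Definition ap_maxlogn (k p : nat) : nat := \max_(i < k) logn p (ap n d i).

Lemma logn_prod_pos p a b (F : nat -> nat) : (forall i, a <= i < b -> 0 < F i) ->
  logn p (\prod_(a <= i < b) F i) = \sum_(a <= i < b) logn p (F i).
Proof.
move=> F0; elim: b F0 => [|b IH] F0; first by rewrite !big_geq ?logn1.
have [ab|ba] := leqP a b; last by rewrite !big_geq ?logn1.
rewrite !big_nat_recr //= lognM ?IH //.
- by move=> i /andP[ai ib]; rewrite F0 // ai ltnW.
- by rewrite big_nat; apply: prodn_cond_gt0 => i /andP[ai ib]; rewrite F0 // ai ltnW.
- by rewrite F0 // ab ltnSn.
Qed.

(** Let i0 be a term in which p has its largest exponent.  For any other i
    the power of p in the i-th term divides i - i0, hence the remaining exponents
    add up to at most the exponent of p in i0! (k-1-i0)!, a divisor of (k-1)!. *)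
Lemma logn_prod_ap k p : prime p -> 0 < k ->
  logn p (\prod_(0 <= i < k) ap n d i) <= logn p (k.-1)`! + ap_maxlogn k p.
Proof.
case: k => // k pp _; rewrite /=.
rewrite logn_prod_pos; last by move=> i _; exact: ap_gt0.
have [i0 e0] : {i0 : 'I_k.+1 | ap_maxlogn k.+1 p = logn p (ap n d i0)}.
  by apply: bigop.eq_bigmax; rewrite card_ord.
have le_max i : i < k.+1 -> logn p (ap n d i) <= logn p (ap n d i0).
  move=> ik; rewrite -e0.
  exact: (bigop.leq_bigmax (F := fun i : 'I_k.+1 => logn p (ap n d i)) (Ordinal ik)).
have i0k : i0 <= k by rewrite -ltnS ltn_ord.
rewrite (@big_cat_nat _ _ _ i0) //=; last exact: ltnW.
rewrite [X in _ + X]big_ltn // e0 addnCA [X in _ <= X]addnC leq_add2l.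
have f1 : \sum_(0 <= i < i0) logn p (ap n d i) <= logn p i0`!.
  rewrite -prod_subn_fact logn_prod_pos; last by move=> i /andP[_]; rewrite subn_gt0.
  rewrite big_nat [X in _ <= X]big_nat; apply: leq_sum => i /andP[_ ii0].
  have := logn_ap_sub pp ii0; rewrite (minn_idPl _) // le_max //.
  exact: ltn_trans ii0 (ltn_ord i0).
have f2 : \sum_(i0.+1 <= i < k.+1) logn p (ap n d i) <= logn p (k - i0)`!.
  rewrite fact_prod logn_prod_pos; last by move=> i /andP[].
  rewrite -[i0.+1]add1n big_addn.
  have -> : k.+1 - i0 = (k - i0).+1 by rewrite subSn.
  rewrite big_nat [X in _ <= X]big_nat; apply: leq_sum => i /andP[i1 ik].
  have lt : i0 < i + i0 by rewrite -{1}[X in X < _]add0n ltn_add2r.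
  have := logn_ap_sub pp lt; rewrite addnK (minn_idPr _) // le_max //.
  by move: ik; rewrite !ltnS; lia.
apply: leq_trans (leq_add f1 f2) _.
rewrite -lognM ?fact_gt0 //; apply: dvdn_leq_log; rewrite ?fact_gt0 //.
by rewrite -(bin_fact i0k) dvdn_mull.
Qed.

Lemma pfactor_ap_maxlogn k p : 0 < k -> 
  p ^ ap_maxlogn k p <= ap n d k.-1.
Proof.
case: k => // k _; rewrite /=.
have [i0 ->] : {i0 : 'I_k.+1 | ap_maxlogn k.+1 p = logn p (ap n d i0)}.
  by apply: bigop.eq_bigmax; rewrite card_ord.
apply: leq_trans (dvdn_leq (ap_gt0 _) (pfactor_dvdnn _ _)) _.
by rewrite /ap leq_add2l leq_mul2r -ltnS ltn_ord orbT.
Qed.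

Lemma ap_maxlogn_dvd k p : prime p -> p %| d -> ap_maxlogn k p = 0.
Proof.
move=> pp pd; rewrite /ap_maxlogn big1 // => i _.
apply/eqP; rewrite -leqn0 leqNgt logn_gt0 mem_primes.
by apply/negP => /and3P[_ _ /(ap_ndvd pp)]; rewrite pd.
Qed.

(** The i-th term is at least i / (k-1) times the last one. *)
Lemma prod_ap_ge k : 0 < k ->
  ap n d k.-1 ^ k.-1 * (k.-1)`! <= k.-1 ^ k.-1 * \prod_(0 <= i < k) ap n d i.
Proof.
case: k => // k _; rewrite /= big_ltn //=.
rewrite mulnCA; apply: leq_trans (leq_pmull _ (ap_gt0 _)).
rewrite fact_prod -{2 5}[k]subn0 -[in X in X <= _]subSS -[in X in _ <= X * _]subSS.
rewrite -!prod_nat_const_nat -!big_split /= big_nat [X in _ <= X]big_nat.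
apply: leq_prod => i /andP[_ ik]; rewrite /ap; nia.
Qed.

(** A smooth product is the product of its p-parts, each bounded by
    logn_prod_ap.  A prime divisor of d divides no term, so its whole share of
    (k-1)! is gained; for d = 2 and d = 3 the estimates for large k depend on this
    gain. *)
Lemma smooth_ap_bound k : 0 < k ->
  (forall i p, i < k -> prime p -> p %| ap n d i -> p <= k) ->
  ap n d k.-1 ^ k.-1 *
    \prod_(0 <= p < k.+1 | prime p && (p %| d)) p ^ logn p (k.-1)`!
  <= k.-1 ^ k.-1 * \prod_(0 <= p < k.+1 | prime p) p ^ ap_maxlogn k p.
Proof.
move=> k0 smooth.
set D := \prod_(0 <= p < k.+1 | _ && _) _.
set E := \prod_(0 <= p < k.+1 | prime p) _.
set Pr := \prod_(0 <= i < k) ap n d i.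
have Pr0 : 0 < Pr by rewrite prodn_gt0 // => i; exact: ap_gt0.
have PrE : Pr = \prod_(0 <= p < k.+1 | prime p) p ^ logn p Pr.
  apply: prod_primes_logn => // p pp.
  by move=> /(prime_dvd_prod_nat pp)[i [_ ik _ pi]]; exact: smooth ik pp pi.
have fE : (k.-1)`! = \prod_(0 <= p < k.+1 | prime p) p ^ logn p (k.-1)`!.
  apply: prod_primes_logn => [|p pp]; first exact: fact_gt0.
  rewrite fact_prod => /(prime_dvd_prod_nat pp)[i [i1 ik _ pi]].
  by have := dvdn_leq i1 pi; lia.
have key : Pr * D <= (k.-1)`! * E.
  rewrite PrE [X in _ <= X * _]fE /D big_mkcondr /= -!big_split /=.
  apply: leq_prod => p pp; case: ifPn => pd.
    rewrite ap_maxlogn_dvd // muln1 (_ : logn p Pr = 0) ?mul1n //.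
    apply/eqP; rewrite -leqn0 leqNgt logn_gt0 mem_primes Pr0 pp /=.
    by apply/negP => /(prime_dvd_prod_nat pp)[i [_ _ _ /(ap_ndvd pp)]]; rewrite pd.
  by rewrite muln1 -expnD leq_exp2l ?prime_gt1 // logn_prod_ap.
rewrite -(leq_pmul2r (fact_gt0 k.-1)) mulnAC.
apply: leq_trans (leq_mul (prod_ap_ge k0) (leqnn D)) _.
by rewrite -!mulnA leq_mul2l -/Pr [E * _]mulnC key orbT.
Qed.
End AP.

Lemma ap_mono n d i j : i <= j -> ap n d i <= ap n d j.
Proof. by move=> ij; rewrite /ap leq_add2l leq_mul2r ij orbT. Qed.

(** * Comparison of large numbers in binary *)

Lemma N_of_muln a b : N.of_nat (a * b) = N.mul (N.of_nat a) (N.of_nat b).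
Proof. exact: Nnat.Nat2N.inj_mul. Qed.

Lemma N_of_expn a b : N.of_nat (a ^ b) = N.pow (N.of_nat a) (N.of_nat b).
Proof.
elim: b => [|b IH]; first by [].
by rewrite expnS N_of_muln IH Nnat.Nat2N.inj_succ N.pow_succ_r'.
Qed.

Lemma N_of_leq a b : N.leb (N.of_nat a) (N.of_nat b) = (a <= b).
Proof. lia. Qed.

Lemma leq_expn_N a b c e :
  N.leb (N.pow (N.of_nat a) (N.of_nat b)) (N.pow (N.of_nat c) (N.of_nat e)) ->
  a ^ b <= c ^ e.
Proof. by rewrite -!N_of_expn N_of_leq. Qed.

Lemma N_of_ltn a b : N.ltb (N.of_nat a) (N.of_nat b) = (a < b).
Proof. lia. Qed.

(** * A Chebyshev bound for primorials *)

Lemma primorialS k :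
  primorial k.+1 = if prime k.+1 then primorial k * k.+1 else primorial k.
Proof.
by rewrite /primorial big_mkcond big_nat_recr //= -big_mkcond /=; case: ifP; rewrite ?muln1.
Qed.

Lemma primepiS k : primepi k.+1 = primepi k + prime k.+1.
Proof.
by rewrite /primepi big_mkcond big_nat_recr //= -big_mkcond /=; case: ifP.
Qed.

Lemma primorial_gt0 k : 0 < primorial k.
Proof. by apply: prodn_cond_gt0 => p /prime_gt0. Qed.

(** Compares the fourth powers of primorials with 2^(7k) for successive k,
    updating the primorial. *)
Fixpoint primorial_check (fuel k : nat) (acc : N) : bool :=
  if fuel is f.+1 then
    N.leb (N.pow acc 4) (N.pow 2 (N.of_nat (7 * k))) &&
    primorial_check f k.+1 (if prime k.+1 then N.mul acc (N.of_nat k.+1) else acc)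
  else true.

Lemma primorial_checkP fuel k : primorial_check fuel k (N.of_nat (primorial k)) ->
  forall m, k <= m < k + fuel -> primorial m ^ 4 <= 2 ^ (7 * m).
Proof.
elim: fuel k => [|f IH] k /=; first by move=> _ m; lia.
move=> /andP[ck cS] m /andP[km mf].
have [e|ne] := eqVneq m k.
  by rewrite e -N_of_leq !N_of_expn.
apply: (IH k.+1); last by lia.
by rewrite primorialS; case: ifP cS; rewrite ?N_of_muln.
Qed.

Lemma primorial_small m : m < 300 -> primorial m ^ 4 <= 2 ^ (7 * m).
Proof.
move=> mlt; apply: (@primorial_checkP 300 0) => //.
have -> : primorial 0 = 1 by rewrite /primorial unlock.
by vm_compute.
Qed.

Lemma logn_fact_wide p n m : prime p -> n <= m ->
  logn p n`! = \sum_(1 <= k < m.+1) n %/ p ^ k.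
Proof.
move=> pp nm; rewrite logn_fact // [RHS](@big_cat_nat _ _ _ n.+1) //=.
rewrite [X in _ + X]big_nat [X in _ + X]big1 ?addn0 // => k /andP[nk _].
by apply: divn_small; apply: ltn_trans nk _; apply: ltn_expl; exact: prime_gt1.
Qed.

Lemma dvdn_logn m n : 0 < m -> 0 < n ->
  (forall p, prime p -> logn p m <= logn p n) -> m %| n.
Proof.
move=> m0 n0 le; apply/dvdn_partP => // p; rewrite mem_primes => /and3P[pp _ _].
by rewrite p_part pfactor_dvdn // le.
Qed.

(** The function floor(6x) + floor(x) - floor(3x) - 2 floor(2x) only takes
    the values 0 and 1, and it is 1 for 1/6 <= x < 1/2. *)
Lemma divn_6321 n q : 0 < q ->
  (3 * n) %/ q + (2 * n) %/ q + (2 * n) %/ q + ((2 * n < q) && (q <= 6 * n))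
    <= (6 * n) %/ q + n %/ q.
Proof.
move=> q0; have rq : n %% q < q by rewrite ltn_mod.
have E c : (c * n) %/ q = c * (n %/ q) + (c * (n %% q)) %/ q.
  by rewrite {1}(divn_eq n q) mulnDr mulnA divnMDl.
rewrite !E; set a := n %/ q in E *; set r := n %% q in rq E *.
have nE : n = a * q + r by rewrite {1}(divn_eq n q).
have lt c m : c * r < m * q -> (c * r) %/ q < m by rewrite ltn_divLR.
have ge c m : m * q <= c * r -> m <= (c * r) %/ q by rewrite leq_divRL.
have a0 : (2 * n < q) && (q <= 6 * n) -> a = 0 /\ 2 * r < q <= 6 * r.
  move=> /andP[h1 h2]; have : a = 0 by apply: divn_small; lia.
  by move=> e; move: h1 h2; rewrite nE e; lia.
have [r2|r2] := leqP q (2 * r).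
  have -> : ((2 * n < q) && (q <= 6 * n)) = false.
    by apply/negP => /a0[_]; lia.
  have := lt 3 3; have := lt 2 2; have := ge 6 3.
  have [r23|r23] := leqP (2 * q) (3 * r); [have := ge 6 4 | have := lt 3 2]; lia.
have := lt 2 1; have := lt 3 2.
have [r13|r13] := leqP q (3 * r); first by have := ge 6 2; have := leq_b1 ((2 * n < q) && (q <= 6 * n)); clear a0 nE E lt ge; lia.
have := lt 3 1; have : ((2 * n < q) && (q <= 6 * n)) <= (6 * r) %/ q.
  by case: (boolP (_ && _)) => // /a0[_ /andP[_ r6]]; apply: ge; lia.
clear a0 nE E lt ge; lia.
Qed.

Definition chebyshev_prod n := \prod_((2 * n).+1 <= p < (6 * n).+1 | prime p) p.

Lemma primorial_chebyshev n : primorial (6 * n) = primorial (2 * n) * chebyshev_prod n.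
Proof. by rewrite /primorial (@big_cat_nat _ _ _ (2 * n).+1) //=; lia. Qed.

Lemma logn_prod_primes q a b : prime q ->
  logn q (\prod_(a <= p < b | prime p) p) = (a <= q < b).
Proof.
move=> pq; elim: b => [|b IH]; first by rewrite big_geq // logn1; lia.
have [ab|ba] := leqP a b; last by rewrite big_geq ?logn1; lia.
rewrite big_mkcond big_nat_recr //= -big_mkcond /= lognM; last 2 first.
- by apply: prodn_cond_gt0 => p /prime_gt0.
- by case: ifP => // /prime_gt0.
rewrite IH; case: ifP => pb.
  by rewrite logn_prime //; case: eqVneq => [->|]; lia.
have : q != b by apply: contraFN pb => /eqP <-.
by rewrite logn1; lia.
Qed.

(** By the formula of Legendre, divn_6321 compares the exponents prime power by
    prime power; the first power accounts for the primes between 2n and 6n. *)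
Lemma chebyshev_dvd n :
  chebyshev_prod n * ((3 * n)`! * ((2 * n)`! * (2 * n)`!)) %| (6 * n)`! * n`!.
Proof.
have P0 : 0 < chebyshev_prod n by apply: prodn_cond_gt0 => p /prime_gt0.
apply: dvdn_logn; rewrite ?muln_gt0 ?fact_gt0 ?P0 // => q pq.
rewrite !lognM ?muln_gt0 ?fact_gt0 ?P0 // logn_prod_primes //.
rewrite !(@logn_fact_wide q _ (6 * n)) //; try lia.
have [n0|n0] := posnP n; first by rewrite n0 !big_geq //; lia.
rewrite -!big_split /=.
rewrite [X in _ + X]big_ltn 1?[X in _ <= X]big_ltn; try lia.
rewrite addnA leq_add //.
  rewrite expn1; apply: leq_trans (divn_6321 n (prime_gt0 pq)).
  by rewrite ltnS addnC addnA.
rewrite big_nat [X in _ <= X]big_nat; apply: leq_sum => k _.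
apply: leq_trans (divn_6321 n (_ : 0 < q ^ k)); last by rewrite expn_gt0 prime_gt0.
by rewrite addnA leq_addr.
Qed.

(** 108 = 6^6 / (3^3 2^2 2^2) is the limit of the ratio of consecutive
    quotients, which increases. *)
Lemma chebyshev_bound n :
  (6 * n)`! * n`! <= 108 ^ n * ((3 * n)`! * ((2 * n)`! * (2 * n)`!)).
Proof.
elim: n => [//|n IH].
have f6 : (6 * n.+1)`! = (6*n+6)*((6*n+5)*((6*n+4)*((6*n+3)*((6*n+2)*((6*n+1) * (6 * n)`!))))).
  by rewrite (_ : 6 * n.+1 = (6*n).+1.+1.+1.+1.+1.+1) ?factS; lia.
have f3 : (3 * n.+1)`! = (3*n+3)*((3*n+2)*((3*n+1) * (3 * n)`!)).
  by rewrite (_ : 3 * n.+1 = (3*n).+1.+1.+1) ?factS; lia.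
have f2 : (2 * n.+1)`! = (2*n+2)*((2*n+1) * (2 * n)`!).
  by rewrite (_ : 2 * n.+1 = (2*n).+1.+1) ?factS; lia.
rewrite f6 f3 f2 factS expnS.
move: IH; set a := (6 * n)`!; set b := n`!; set c := 108 ^ n; set e := (3 * n)`!.
set f := (2 * n)`! => IH.
set u := 72 * (n.+1 * n.+1 * (3*n+2) * (3*n+1) * (2*n+1)).
have -> : (6*n+6)*((6*n+5)*((6*n+4)*((6*n+3)*((6*n+2)*((6*n+1) * a))))) * (n.+1 * b)
  = (u * ((6*n+5) * (6*n+1))) * (a * b) by rewrite /u; lia.
have -> : 108 * c * ((3*n+3)*((3*n+2)*((3*n+1) * e)) * ((2*n+2)*((2*n+1) * f) * ((2*n+2)*((2*n+1) * f))))
  = (u * (18 * (n.+1 * (2*n+1)))) * (c * (e * (f * f))) by rewrite /u; lia.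
by apply: leq_mul IH; rewrite leq_mul2l; apply/orP; right; nia.
Qed.

Lemma chebyshev_prod_le n : chebyshev_prod n <= 108 ^ n.
Proof.
have pos : 0 < (3 * n)`! * ((2 * n)`! * (2 * n)`!) by rewrite !muln_gt0 !fact_gt0.
rewrite -(leq_pmul2r pos); apply: leq_trans (chebyshev_bound n).
by apply: dvdn_leq (chebyshev_dvd n); rewrite muln_gt0 !fact_gt0.
Qed.

Lemma primorial_mono a b : a <= b -> primorial a <= primorial b.
Proof.
move=> /subnK <-; elim: (b - a) => [//|c IH]; apply: leq_trans IH _.
by rewrite addSn primorialS; case: ifP => // _; exact: leq_pmulr.
Qed.

Lemma primorial_step a e n k : a ^ 16 <= 2 ^ e -> e * n + 56 * n <= 28 * k ->
  2 ^ (7 * (2 * n)) * (a ^ n) ^ 4 <= 2 ^ (7 * k).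
Proof.
move=> ae le; rewrite -(@leq_exp2r _ _ 4) // expnMn.
have -> : ((a ^ n) ^ 4) ^ 4 = (a ^ 16) ^ n by rewrite -!expnM mulnC.
apply: leq_trans (_ : (2 ^ (7 * (2 * n))) ^ 4 * (2 ^ e) ^ n <= _).
  rewrite leq_mul2l; apply/orP; right; case: (n) => // m; by rewrite leq_exp2r.
by rewrite -!expnM -expnD leq_exp2l //; lia.
Qed.

(** Splitting off the primes between 2n and 6n, with n about k/6, gives an
    exponent (log_2 108) / 4 < 1.689 per unit of k; the distance to 7/4 absorbs the
    rounding of n from k = 300 on. *)
Lemma primorial_le k : primorial k ^ 4 <= 2 ^ (7 * k).
Proof.
elim/ltn_ind: k => k IH.
have [/primorial_small //|k300] := ltnP k 300.
pose n := (k + 5) %/ 6.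
have [kn nk] : k <= 6 * n /\ 6 * n <= k + 5 by rewrite /n; lia.
apply: leq_trans (_ : primorial (6 * n) ^ 4 <= _); first by rewrite leq_exp2r ?primorial_mono.
rewrite primorial_chebyshev expnMn.
apply: leq_trans (_ : 2 ^ (7 * (2 * n)) * (108 ^ n) ^ 4 <= _).
  by apply: leq_mul; [apply: IH; lia | rewrite leq_exp2r // chebyshev_prod_le].
apply: (@primorial_step _ 109); last by lia.
by apply: leq_expn_N; vm_compute.
Qed.

(** * Smooth progressions with fewer than 4097 terms *)

Definition smooth_ap (n d k : nat) : Prop :=
  forall i p, i < k -> prime p -> p %| ap n d i -> p <= k.

(** Every prime p <= k is charged with the full power p^e <= M that may
    have been lost in the exceptional term. *)
Lemma smooth_ap_crude n d k : 0 < n -> coprime n d -> 0 < k -> smooth_ap n d k ->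
  ap n d k.-1 ^ k.-1 <= k.-1 ^ k.-1 * ap n d k.-1 ^ primepi k.
Proof.
move=> n0 nd k0 sm; have := smooth_ap_bound n0 nd k0 sm.
set D := \prod_(0 <= p < _ | _ && _) _ => le.
have D0 : 0 < D.
  by apply: prodn_cond_gt0 => p /andP[pp _]; rewrite expn_gt0 prime_gt0.
apply: leq_trans (leq_pmulr _ D0) (leq_trans le _).
rewrite leq_mul2l; apply/orP; right.
rewrite /primepi (big_morph (expn (ap n d k.-1)) (expnD _) (expn0 _)).
by apply: leq_prod => p _; rewrite expn1 pfactor_ap_maxlogn.
Qed.

(** The progressions of k terms with last term at most 256. *)
Definition small_check (k : nat) : bool :=
  all (fun d => all (fun n =>
      if coprime n d then
        find (fun i => k < max_pdiv (ap n d i)) (iota 0 k) < k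
      else true)
    (iota 1 (256 - d * k.-1))) (iota 2 (256 %/ k.-1)).

(** 257^(k-1-pi(k)) > (k-1)^(k-1), which together with smooth_ap_crude
    forces the last term of a smooth progression to be at most 256. *)
Definition size_check (k : nat) : bool :=
  let e := k.-1 - primepi k in
  (primepi k <= k.-1) &&
  N.ltb (N.pow (N.of_nat k.-1) (N.of_nat k.-1)) (N.pow 257 (N.of_nat e)).

Lemma small_check_all : all (fun k => size_check k && small_check k) (iota 4 30).
Proof.
have E k : primepi k = size [seq p <- iota 0 k.+1 | prime p].
  by rewrite /primepi -big_filter big_const_seq count_predT iter_addn_0 mul1n.
rewrite /size_check; under eq_all => k do rewrite E.
by vm_compute.
Qed.

Lemma not_smooth_small n d k : 0 < n -> 1 < d -> coprime n d -> 4 <= k < 34 ->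
  ~ smooth_ap n d k.
Proof.
move=> n0 d1 nd /andP[k4 k34] sm.
have /allP/(_ k) := small_check_all; rewrite mem_iota k4 => /(_ k34).
move=> /andP[/andP[pik szk] chk].
have k0 : 0 < k by lia.
have := smooth_ap_crude n0 nd k0 sm; set M := ap n d k.-1 => le.
have M0 : 0 < M by exact: ap_gt0.
have M256 : M <= 256.
  rewrite leqNgt; apply/negP => M257.
  move: szk; rewrite -[257%num]/(N.of_nat 257) -!N_of_expn N_of_ltn => szk.
  move: le; rewrite -{1}(subnK pik) expnD leq_pmul2r ?expn_gt0 ?M0 // leqNgt.
  move/negP; apply; apply: leq_trans szk _.
  by case: (_ - _) => [|e]; rewrite ?expn0 // leq_exp2r.
have dk : d * k.-1 <= 256 by move: M256; rewrite /M /ap; nia.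
move/allP: chk => /(_ d); rewrite mem_iota d1.
have -> : d < 2 + 256 %/ k.-1.
  by have : d <= 256 %/ k.-1; [rewrite leq_divRL //; lia | lia].
move=> /(_ isT)/allP/(_ n); rewrite mem_iota n0 nd.
have -> : n < 1 + (256 - d * k.-1) by move: M256; rewrite /M /ap; lia.
have := has_find (fun i => k < max_pdiv (ap n d i)) (iota 0 k).
rewrite size_iota => <- /(_ isT)/hasP[i].
rewrite mem_iota => /andP[_ ik] lt.
have T0 : 0 < ap n d i by exact: ap_gt0.
have [T1|T1] := leqP (ap n d i) 1.
  have e : ap n d i = 1 by lia.
  by move: lt; rewrite e (_ : max_pdiv 1 = 1) //; lia.
by have := sm _ _ ik (max_pdiv_prime T1) (max_pdiv_dvd _); rewrite leqNgt lt.
Qed.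

Fixpoint primepi_check (fuel k pi : nat) : bool :=
  if fuel is f.+1 then
    ((trunc_log 2 k).+4 * pi <= 3 * k.-1) &&
    primepi_check f k.+1 (pi + prime k.+1)
  else true.

Lemma primepi_checkP fuel k : primepi_check fuel k (primepi k) ->
  forall m, k <= m < k + fuel -> (trunc_log 2 m).+4 * primepi m <= 3 * m.-1.
Proof.
elim: fuel k => [|f IH] k /=; first by move=> _ m; lia.
move=> /andP[ck cS] m /andP[km mf].
have [-> //|ne] := eqVneq m k.
by apply: (IH k.+1); [rewrite primepiS | lia].
Qed.

(** Since m < 2^j with j = (trunc_log 2 m).+1, this implies
    (m-1)^pi(m) <= 8^(m-1-pi(m)). *)
Lemma primepi_le_log m : 34 <= m < 4097 -> (trunc_log 2 m).+4 * primepi m <= 3 * m.-1.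
Proof.
move=> mm; apply: (@primepi_checkP 4063 34) => //.
have -> : primepi 34 = size [seq p <- iota 0 35 | prime p].
  by rewrite /primepi -big_filter big_const_seq count_predT iter_addn_0 mul1n.
by vm_compute.
Qed.

(** With x = max(k, n-1) and n < (8-d)(k-1), a prime q congruent to n
    modulo d with x < q and chain_step d x q is one of the terms
    (see chain_step_window). *)
Definition chain_step (d a b : nat) : bool := (b * (8 - d) <= 8 * a) && (b <= 3 * a).

Lemma chainP d a l x : path (chain_step d) a l -> a <= x < last a l ->
  exists2 q, q \in l & x < q /\ chain_step d x q.
Proof.
elim: l a => [|b l IH] a /=; first by lia.
move=> /andP[ab pl] /andP[ax xl].
have [xb|bx] := ltnP x b.
  exists b; first exact: mem_head.
  by move: ab; rewrite /chain_step; split=> //; nia.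
have [|q ql h] := IH b pl; first by rewrite bx.
by exists q => //; rewrite inE ql orbT.
Qed.

(** Each step takes the largest admissible prime of the class of r
    modulo d.  The range from 34 to 6 * 4096 covers all values of max(k, n-1) that
    have to be considered. *)
Fixpoint greedy_chain (d r fuel a : nat) : seq nat :=
  if fuel is f.+1 then
    let s := rev (iota a.+1 (minn (3 * a) ((8 * a) %/ (8 - d)) - a)) in
    let b := nth 0 s (find (fun q => if q %% d == r then prime q else false) s) in
    b :: (if b <= 6 * 4096 then greedy_chain d r f b else [::])
  else [::].

Lemma chain_check_all :
  all (fun d => all (fun r =>
     if coprime r d then
       let l := greedy_chain d r 30 34 in
       [&& path (chain_step d) 34 l, 6 * 4096 <= last 34 l
         & all (fun q => prime q && (q %% d == r)) l]
     else true)
     (iota 0 d)) (iota 2 6).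
Proof. by vm_compute. Qed.

Lemma prime_in_class d r x : 2 <= d <= 7 -> r < d -> coprime r d -> 34 <= x < 6 * 4096 ->
  exists q, [/\ prime q, q %% d = r, x < q & chain_step d x q].
Proof.
move=> d27 rd crd /andP[x34 xlt]; have /allP/(_ d) := chain_check_all.
rewrite mem_iota => /(_ d27)/allP/(_ r); rewrite mem_iota => /(_ rd).
rewrite crd => /and3P[pl ll /allP pr].
have [|q ql [xq st]] := chainP pl (x := x); first by rewrite x34; apply: leq_trans ll.
by have /andP[pq /eqP qr] := pr _ ql; exists q.
Qed.

Lemma chain_step_window d k n q : 1 < d <= 7 -> 0 < n -> n < (8 - d) * k.-1 ->
  chain_step d (maxn k n.-1) q -> q - n < k * d.
Proof.
by case/andP; case: d => [|[|[|[|[|[|[|[|d]]]]]]]] //; rewrite /chain_step => _ _ n0 nk /andP[]; lia.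
Qed.

(** The crude bound gives M < 8 (k-1), hence d <= 7, and then a prime
    of the chain modulo d lies beyond k among the terms. *)
Lemma not_smooth_medium n d k : 0 < n -> 1 < d -> coprime n d -> 34 <= k < 4097 ->
  ~ smooth_ap n d k.
Proof.
move=> n0 d1 nd /andP[k34 k4096] sm.
have k0 : 0 < k by lia.
have := smooth_ap_crude n0 nd k0 sm; set M := ap n d k.-1 => le.
have M0 : 0 < M by exact: ap_gt0.
have km : 34 <= k < 4097 by rewrite k34.
have := primepi_le_log km; set j := trunc_log 2 k => pile.
have kj : k.-1 < 2 ^ j.+1.
  by apply: leq_ltn_trans (leq_pred k) (trunc_log_ltn _ _).
have pik : primepi k <= k.-1 by nia.
have M8 : M < 8 * k.-1.
  rewrite ltnNge; apply/negP => M8.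
  have le' : M ^ (k.-1 - primepi k) <= k.-1 ^ (k.-1 - primepi k) * k.-1 ^ primepi k.
    by rewrite -expnD subnK // -(leq_pmul2r (_ : 0 < M ^ primepi k)) ?expn_gt0 ?M0 // -expnD subnK.
  move: le'.
  rewrite leqNgt => /negP; apply.
  have e0 : 0 < k.-1 - primepi k by nia.
  apply: leq_trans (_ : (8 * k.-1) ^ (k.-1 - primepi k) <= _); last by rewrite leq_exp2r.
  rewrite expnMn mulnC ltn_pmul2r ?expn_gt0; last by apply/orP; left; lia.
  have pi0 : 0 < primepi k.
    by rewrite /primepi (@big_cat_nat _ _ _ 3) //=; [rewrite unlock /= | lia].
  apply: leq_trans (_ : (2 ^ j.+1) ^ primepi k <= _); first by rewrite ltn_exp2r.
  by rewrite -expnM -[8]/(2 ^ 3) -expnM leq_exp2l //; lia.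
have d7 : d <= 7 by move: M8; rewrite /M /ap; nia.
have nlt : n < (8 - d) * k.-1 by move: M8; rewrite /M /ap; nia.
pose x := maxn k n.-1.
have x34 : 34 <= x < 6 * 4096.
  have : n < 6 * k.-1 by apply: leq_trans nlt _; rewrite leq_mul2r; lia.
  rewrite /x; lia.
have rd : n %% d < d by rewrite ltn_mod; lia.
have crd : coprime (n %% d) d by rewrite coprime_modl.
have d27 : 2 <= d <= 7 by rewrite d1.
have [q [pq qn xq st]] := prime_in_class d27 rd crd x34.
have nq : n <= q by move: xq; rewrite /x; lia.
have kq : k < q by move: xq; rewrite /x; lia.
have dq : d %| q - n by rewrite -eqn_mod_dvd // qn.
have qE : ap n d ((q - n) %/ d) = q by rewrite /ap divnK // subnKC.
have ik : (q - n) %/ d < k.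
  rewrite ltn_divLR; last by apply: ltnW.
  exact: chain_step_window nlt st.
have := sm _ _ ik pq; rewrite qE dvdnn => /(_ isT); lia.
Qed.

(** * Prime counts and the 2- and 3-parts of factorials *)

Lemma prime_mod6 p : prime p -> 3 < p -> (p %% 6 == 1) || (p %% 6 == 5).
Proof.
move=> pp p3.
have p2 : ~~ (2 %| p) by rewrite dvdn_prime2 //; lia.
have p3' : ~~ (3 %| p) by rewrite dvdn_prime2 //; lia.
by move: p2 p3'; lia.
Qed.

(** A prime above 3 is congruent to 1 or 5 modulo 6. *)
Lemma primepi_le k : 3 * primepi k <= k + 6.
Proof.
have H m : primepi (6 * m + 5) <= 2 * m + 3 /\ primepi (6 * m + 4) <= 2 * m + 2.
  elim: m => [|m [IH _]].
    by rewrite /primepi !unlock /=.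
  have np c : c \in [:: 6; 8; 9; 10] -> prime (6 * m + c) = false.
    move=> cc; apply/negP => pc; have := prime_mod6 pc; move: cc.
    by rewrite !inE => /or4P[] /eqP ->; lia.
  have st c : primepi (6 * m + c.+1) = primepi (6 * m + c) + prime (6 * m + c.+1).
    by rewrite addnS primepiS.
  have -> : 6 * m.+1 + 5 = 6 * m + 11 by lia.
  have -> : 6 * m.+1 + 4 = 6 * m + 10 by lia.
  rewrite (st 10) (st 9) (st 8) (st 7) (st 6) (st 5) (np 6) ?(np 8) ?(np 9) ?(np 10) //.
  by case: (prime _); case: (prime _); lia.
have mono a b : a <= b -> primepi a <= primepi b.
  move=> /subnK <-; elim: (b - a) => [//|c IH]; apply: leq_trans IH _.
  by rewrite addSn primepiS leq_addr.
have [h5 h4] := H (k %/ 6); have kE := divn_eq k 6.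
have [r|r] := leqP 5 (k %% 6).
  by have := mono k (6 * (k %/ 6) + 5); lia.
by have := mono k (6 * (k %/ 6) + 4); lia.
Qed.

(** The square of a prime above s exceeds the last term, so only the
    primes up to s may contribute more than their first power. *)
Lemma prod_maxlogn_le n d k s : 0 < n -> 0 < k -> ap n d k.-1 < s.+1 ^ 2 ->
  \prod_(0 <= p < k.+1 | prime p) p ^ ap_maxlogn n d k p
    <= primorial k * ap n d k.-1 ^ primepi s.
Proof.
move=> n0 k0 Ms; set M := ap n d k.-1.
have M0 : 0 < M by exact: ap_gt0.
have -> : M ^ primepi s = \prod_(0 <= p < s.+1 | prime p) M.
  by rewrite /primepi (big_morph (expn M) (expnD _) (expn0 _)).
apply: leq_trans (_ : primorial k *
    \prod_(0 <= p < k.+1 | prime p) (if p <= s then M else 1) <= _).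
  rewrite /primorial -big_split /=; apply: leq_prod => p pp.
  have pe : p ^ ap_maxlogn n d k p <= M by exact: pfactor_ap_maxlogn.
  case: ifPn => ps.
    by apply: leq_trans pe _; rewrite leq_pmull // prime_gt0.
  rewrite muln1; suff e1 : ap_maxlogn n d k p <= 1.
    by apply: leq_trans (leq_pexp2l (prime_gt0 pp) e1) _; rewrite expn1.
  rewrite leqNgt; apply/negP => e2.
  have : p ^ 2 <= M by apply: leq_trans (leq_pexp2l (prime_gt0 pp) e2) pe.
  rewrite leqNgt => /negP; apply; apply: leq_trans Ms _.
  by rewrite leq_exp2r // ltnNge.
rewrite leq_mul2l; apply/orP; right.
have bound a b : a <= b -> \prod_(0 <= p < a.+1 | prime p) (if p <= s then M else 1)
   <= \prod_(0 <= p < b.+1 | prime p) (if p <= s then M else 1).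
  move=> ab; rewrite [X in _ <= X](@big_cat_nat _ _ _ a.+1) //= leq_pmulr //.
  by apply: prodn_cond_gt0 => p _; case: ifP.
apply: leq_trans (bound k (maxn k s) (leq_maxl _ _)) _.
rewrite (@big_cat_nat _ _ _ s.+1) //=; last by rewrite ltnS leq_maxr.
rewrite [X in _ * X]big_nat_cond [X in _ * X]big1 ?muln1.
  rewrite big_nat_cond [X in _ <= X]big_nat_cond.
  by apply: leq_prod => p /andP[/andP[_ ps] _]; rewrite (_ : p <= s).
by move=> p /andP[/andP[sp _] _]; rewrite leqNgt sp.
Qed.

Lemma logn2_fact_double h : logn 2 (2 * h)`! = h + logn 2 h`!.
Proof.
elim: h => [//|h IH].
have -> : 2 * h.+1 = (2 * h).+2 by lia.
rewrite !factS !lognM ?muln_gt0 ?fact_gt0 // IH.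
have -> : logn 2 (2 * h).+2 = (logn 2 h.+1).+1.
  by rewrite (_ : (2 * h).+2 = 2 * h.+1) ?lognM //; lia.
have -> : logn 2 (2 * h).+1 = 0.
  apply/eqP; rewrite -leqn0 leqNgt logn_gt0 mem_primes /= dvdn2 /=; lia.
lia.
Qed.

Lemma logn3_fact_triple h : logn 3 (3 * h)`! = h + logn 3 h`!.
Proof.
elim: h => [//|h IH].
have -> : 3 * h.+1 = (3 * h).+3 by lia.
rewrite !factS !lognM ?muln_gt0 ?fact_gt0 // IH.
have -> : logn 3 (3 * h).+3 = (logn 3 h.+1).+1.
  by rewrite (_ : (3 * h).+3 = 3 * h.+1) ?lognM //; lia.
have nd c : ~~ (3 %| c) -> logn 3 c = 0.
  move=> c3; apply/eqP; rewrite -leqn0 leqNgt logn_gt0 mem_primes /=.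
  by apply/negP => /andP[_ c3']; rewrite c3' in c3.
rewrite (nd (3 * h).+1) ?(nd (3 * h).+2); lia.
Qed.

Lemma dvdn_fact_fact a b : a <= b -> a`! %| b`!.
Proof. by move=> ab; rewrite -(bin_fact ab) mulnCA dvdn_mulr. Qed.

(** The exponent of 2 in m! is m minus the number of binary digits 1 of m. *)
Lemma pow2_fact m : 2 ^ m <= m.+1 * 2 ^ logn 2 m`!.
Proof.
elim/ltn_ind: m => m IH.
have [->//|m0] := posnP m.
pose h := m %/ 2.
have := IH h (_ : h < m); rewrite /h => /(_ ltac:(lia)); rewrite -/h => IHh.
have le : logn 2 (2 * h)`! <= logn 2 m`!.
  by apply: dvdn_leq_log; rewrite ?fact_gt0 // dvdn_fact_fact // /h; lia.
apply: leq_trans (_ : m.+1 * 2 ^ (h + logn 2 h`!) <= _); last first.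
  by rewrite leq_mul2l leq_exp2l // -logn2_fact_double le orbT.
rewrite expnD; move: IHh; set a := 2 ^ h; set v := 2 ^ logn 2 _ => IHh.
have aa := leq_mul (leqnn a) IHh.
have [e|e] : m = 2 * h \/ m = (2 * h).+1 by rewrite /h; lia.
  have -> : 2 ^ m = a * a by rewrite e mul2n -addnn expnD.
  apply: leq_trans aa _; rewrite mulnCA leq_mul2r; lia.
have -> : 2 ^ m = 2 * (a * a) by rewrite e expnS (mul2n h) -addnn expnD.
apply: leq_trans (leq_mul (leqnn 2) aa) _.
by rewrite (_ : 2 * _ = (2 * h.+1) * (a * v)) ?leq_mul2r; lia.
Qed.

(** The exponent of 3 in m! is at least the integer part of m / 3, and
    64 <= 3^4. *)
Lemma pow43_fact m : 4 ^ m <= m.+1 * (3 ^ m * 3 ^ logn 3 m`!).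
Proof.
pose h := m %/ 3.
have le : h <= logn 3 m`!.
  apply: leq_trans (leq_addr (logn 3 h`!) h) _; rewrite -logn3_fact_triple.
  by apply: dvdn_leq_log; rewrite ?fact_gt0 // dvdn_fact_fact // /h; lia.
apply: leq_trans (_ : m.+1 * (3 ^ m * 3 ^ h) <= _); last first.
  by rewrite !leq_mul2l leq_exp2l // le !orbT.
have e64 : 64 ^ h <= 27 ^ h * 3 ^ h by rewrite -expnMn; case: (h) => // c; rewrite leq_exp2r.
have e r : 4 ^ (3 * h + r) = 64 ^ h * 4 ^ r by rewrite expnD expnM.
have e3 r : 3 ^ (3 * h + r) = 27 ^ h * 3 ^ r by rewrite expnD expnM.
have [E|[E|E]] : m = 3 * h + 0 \/ m = 3 * h + 1 \/ m = 3 * h + 2 by rewrite /h; lia.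
- rewrite [in X in X <= _]E [in X in _ <= _ * (X * _)]E e e3 !muln1.
  by apply: leq_trans e64 _; apply: leq_pmull.
- rewrite [in X in X <= _]E [in X in _ <= _ * (X * _)]E e e3 !expn1; nia.
- rewrite [in X in X <= _]E [in X in _ <= _ * (X * _)]E e e3; nia.
Qed.

(** * Logarithmic estimates for long smooth progressions *)

Local Open Scope ring_scope.

Section RealPart.
Variable R : realType.
Implicit Types x y : R.

Lemma ln2_ge : 1 / 2 <= ln (2 : R).
Proof.
have := @le_ln1Dx R (- (1/2)) _; rewrite (_ : 1 + - (1/2) = 2^-1); last by field.
rewrite lnV ?posrE //; lra.
Qed.

Lemma ler_ln_nat (a b : nat) : (0 < a)%N -> (a <= b)%N -> ln (a%:R : R) <= ln b%:R.
Proof. by move=> a0 ab; rewrite ler_ln ?posrE ?ltr0n ?ler_nat //; apply: leq_trans ab. Qed.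

Lemma lnX_nat (a e : nat) : (0 < a)%N -> ln ((a ^ e)%:R : R) = e%:R * ln a%:R.
Proof. by move=> a0; rewrite natrX lnXn ?ltr0n // mulr_natl. Qed.

Lemma lnM_nat (a b : nat) : (0 < a)%N -> (0 < b)%N ->
  ln ((a * b)%:R : R) = ln a%:R + ln b%:R.
Proof. by move=> a0 b0; rewrite natrM lnM ?posrE ?ltr0n. Qed.

Lemma ln_nat_ge0 (a : nat) : (0 < a)%N -> 0 <= ln (a%:R : R).
Proof. by move=> a0; rewrite ln_ge0 // ler1n. Qed.

(** The tangent line 1 + z <= exp z.  It is used with L = ln 2, where 12 L
    is the logarithm of 4096. *)
Lemma ln_linear_decay (c x L : R) : 0 <= L -> 1 <= 12 * c * L -> 12 * L <= x ->
  x <= 12 * L * expR (c * (x - 12 * L)).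
Proof.
move=> L0 cL xL; apply: le_trans (_ : 12 * L * (1 + c * (x - 12 * L)) <= _).
  have -> : 12 * L * (1 + c * (x - 12 * L)) = x + (12 * c * L - 1) * (x - 12 * L) by ring.
  by rewrite lerDl mulr_ge0 // subr_ge0.
by rewrite ler_wpM2l ?mulr_ge0 // expR_ge1Dx.
Qed.

(** From here to log_ratio_lt4, K = k-1, and ka, mu, nu are the logarithms of K, of
    the last term M and of max(M, 4 K).  This is smooth_ap_crude with p = pi(k)
    at most about k/3, which leaves the exponent 3/2 plus a margin. *)
Lemma log_last_term_le (K ka mu p : R) : 64 * 64 <= K -> 0 <= ka -> 0 <= mu ->
  K * mu <= K * ka + p * mu -> 3 * p <= K + 7 -> mu <= 37 / 24 * ka.
Proof.
move=> Kr ka0 mu0 hA pr.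
have h1 : (2 * K - 7) * mu <= 3 * (K * ka).
  have := ler_wpM2r mu0 pr; lra.
have p7 : 0 < 2 * K - 7 by lra.
rewrite -(ler_pM2l p7); apply: le_trans h1 _.
have h3 : 0 <= (2 * K - 4 * 65) * ka by rewrite mulr_ge0 //; lra.
lra.
Qed.

Lemma log_le_linear (K ka L : R) : 1 / 2 <= L -> 12 * L <= ka -> expR ka = K ->
  expR (12 * L) = 64 * 64 -> ka <= 3 / (16 * 64) * L * K.
Proof.
move=> L12 ka12 eK e12.
have L0 : 0 <= L by lra.
have cL : 1 <= 12 * 1 * L by lra.
have := ln_linear_decay L0 cL ka12.
by rewrite mul1r expRD eK expRN e12; lra.
Qed.

Lemma log_le_sqrt (ka L : R) : 1 / 2 <= L -> 12 * L <= ka ->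
  expR (12 * L) = 64 * 64 -> ka <= 3 / 16 * L * expR (ka / 2).
Proof.
move=> L12 ka12 e12.
have L0 : 0 <= L by lra.
have cL : 1 <= 12 * (1/2) * L by lra.
have := ln_linear_decay L0 cL ka12.
have e6 : expR (6 * L) = 64.
  have : expR (6 * L) ^+ 2 = 64 ^+ 2.
    by rewrite -expRM_natl (_ : 2%:R * (6 * L) = 12 * L) ?e12; ring.
  by move/eqP; rewrite eqrXn2 ?expR_ge0 // => /eqP.
rewrite (_ : 1 / 2 * (ka - 12 * L) = ka / 2 - 6 * L); last by field.
by rewrite expRD expRN e6; lra.
Qed.

Lemma log_le_power (K ka L : R) : 1 / 2 <= L -> 12 * L <= ka -> expR ka = K ->
  expR L = 2 -> ka * expR (37 / 48 * ka) <= 120 / 67 * L * K.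
Proof.
move=> L12 ka12 eK e1.
have L0 : 0 <= L by lra.
have cL : 1 <= 12 * (11/48) * L by lra.
have := ln_linear_decay L0 cL ka12.
have e11 : 67 / 10 <= expR (11 / 4 * L).
  have p67 : 0 <= 67 / 10 :> R by lra.
  rewrite -(@ler_pXn2r _ 4) ?nnegrE ?expR_ge0 ?p67 //.
  rewrite -expRM_natl (_ : 4%:R * (11 / 4 * L) = 11%:R * L); last by field.
  by rewrite expRM_natl e1; lra.
rewrite (_ : 11 / 48 * (ka - 12 * L) = 11 / 48 * ka - 11 / 4 * L); last by field.
rewrite expRD expRN => le.
have E0 : 0 <= expR (37 / 48 * ka) by exact: expR_ge0.
apply: le_trans (ler_wpM2r E0 le) _.
rewrite -eK (_ : expR ka = expR (11 / 48 * ka) * expR (37 / 48 * ka)); last first.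
  by rewrite -expRD; congr expR; field.
set a := expR (11/48 * _); set b := expR (37/48 * _); set c := expR _.
have ab0 : 0 <= L * (a * b) by rewrite !mulr_ge0 ?expR_ge0.
have c0 : 0 < c by exact: expR_gt0.
have ci : c^-1 <= 10 / 67.
  have ci0 : 0 <= c^-1 by rewrite invr_ge0 ltW.
  have := ler_wpM2l ci0 e11; rewrite mulVf ?gt_eqF //; lra.
have := ler_wpM2l ab0 ci; lra.
Qed.

(** The bound M <= K^(37/24) makes sqrt(M) ln M smaller than K, and the
    refined inequality then gives max(M, 4 K) <= 2^(27/10) K.  Here L = ln 2,
    s is the integer part of sqrt(M), p = pi(s), and lk, lP are the logarithms
    of k and of primorial k. *)
Lemma log_ratio_le (K ka mu nu L p s lk lP : R) :
  64 * 64 <= K -> 1 / 2 <= L -> 12 * L <= ka -> expR ka = K -> expR L = 2 ->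
  expR (12 * L) = 64 * 64 -> 0 <= mu -> 0 <= p ->
  mu <= 37 / 24 * ka -> 3 * p <= s + 6 -> s <= expR (mu / 2) ->
  lk <= ka + L -> lP <= 7 / 4 * (K + 1) * L ->
  K * nu <= lk + K * ka + lP + p * mu -> nu <= ka + 27 / 10 * L.
Proof.
move=> Kr L12 ka12 eK e1 e12 mu0 p0 muA ps se lke lPe hB.
have d1 := log_le_linear L12 ka12 eK e12.
have d3 := log_le_power L12 ka12 eK e1.
have se2 : s <= expR (37 / 48 * ka).
  by apply: le_trans se _; rewrite ler_expR; lra.
have ka0 : 0 <= ka by lra.
have pmu : p * mu <= (expR (37 / 48 * ka) / 3 + 2) * (37 / 24 * ka).
  by apply: ler_pM => //; lra.
have K0 : 0 < K by lra.
rewrite -(ler_pM2l K0).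
have LK : 64 * 64 * L <= L * K by rewrite mulrC ler_wpM2l //; lra.
move: d3 pmu; set E := expR _ => d3 pmu.
lra.
Qed.

(** Once M = O(K), the term in sqrt(M) ln M costs less than the gap
    between 4 and 2^(7/4), so that max(M, 4 K) < 4 K, a contradiction. *)
Lemma log_ratio_lt4 (K ka mu nu L p s lk lP : R) :
  64 * 64 <= K -> 1 / 2 <= L -> 12 * L <= ka -> expR ka = K -> expR L = 2 ->
  expR (12 * L) = 64 * 64 -> 0 <= mu -> 0 <= p ->
  mu <= nu -> 3 * p <= s + 6 -> s <= expR (mu / 2) ->
  lk <= ka + L -> lP <= 7 / 4 * (K + 1) * L -> ka + 2 * L <= nu ->
  nu <= ka + 27 / 10 * L ->
  K * nu <= lk + K * ka + lP + p * mu -> False.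
Proof.
move=> Kr L12 ka12 eK e1 e12 mu0 p0 munu ps se lke lPe nu2 nuB hB.
have d2 := log_le_sqrt L12 ka12 e12.
have ka0 : 0 <= ka by lra.
have K0 : 0 < K by lra.
set r := expR (ka / 2) in d2.
have rK : r * r = K by rewrite /r -expRD -eK; congr expR; field.
have r64 : 64 <= r.
  rewrite leNgt; apply/negP => rlt.
  have r0 : 0 < r by exact: expR_gt0.
  have : r * r < 64 * 64 by rewrite ltr_pM // ltW.
  by rewrite rK; lra.
have e135 : expR (27 / 20 * L) <= 64 / 25.
  have p64 : 0 <= 64 / 25 :> R by lra.
  rewrite -(@ler_pXn2r _ 20) ?nnegrE ?expR_ge0 ?p64 //.
  rewrite -expRM_natl (_ : 20%:R * (27 / 20 * L) = 27%:R * L); last by field.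
  by rewrite expRM_natl e1; lra.
have se2 : s <= 64 / 25 * r.
  apply: le_trans se _; apply: le_trans (_ : expR (27 / 20 * L + ka / 2) <= _).
    by rewrite ler_expR; lra.
  by rewrite expRD ler_wpM2r // expR_ge0.
have pmu : p * mu <= (64 / 75 * r + 2) * (3 / 16 * L * r + 27 / 10 * L).
  by apply: ler_pM => //; lra.
have Knu : K * (ka + 2 * L) <= K * nu by rewrite ler_pM2l.
have Lr : 64 * L <= L * r by rewrite mulrC ler_wpM2l //; lra.
have Lrr : 64 * (L * r) <= L * r * r by rewrite mulrC ler_wpM2l // mulr_ge0 //; lra.
move: pmu Knu hB lPe; rewrite -rK; lra.
Qed.

Lemma smooth_bounds_contradiction (k M s V P pik pis : nat) :
  (4097 <= k)%N -> (0 < M)%N -> (0 < P)%N ->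
  (M ^ k.-1 <= k.-1 ^ k.-1 * M ^ pik)%N -> (3 * pik <= k + 6)%N ->
  (V ^ k.-1 <= k * k.-1 ^ k.-1 * P * M ^ pis)%N -> (3 * pis <= s + 6)%N ->
  (s ^ 2 <= M)%N -> (M <= V)%N -> (4 * k.-1 <= V)%N -> (P ^ 4 <= 2 ^ (7 * k))%N ->
  False.
Proof.
move=> k4097 M0 P0 crude lepik fine lepis sM MV VK leP.
have K1 : (4096 <= k.-1)%N by lia.
have kE : k = k.-1.+1 by lia.
move: k.-1 K1 kE crude fine VK => K K1 kE crude fine VK; subst k.
have K0 : (0 < K)%N by lia.
have V0 : (0 < V)%N by lia.
pose L : R := ln 2; pose ka : R := ln K%:R; pose mu : R := ln M%:R; pose nu : R := ln V%:R.
have L12 : 1 / 2 <= L := ln2_ge.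
have Kr : 64 * 64 <= K%:R :> R by rewrite -natrM ler_nat.
have ln4096 : ln (64 * 64 : R) = 12 * L.
  by rewrite (_ : 64 * 64 = 2 ^+ 12) ?lnXn //; [rewrite /L mulr_natl | ring].
have ka12 : 12 * L <= ka by rewrite -ln4096 ler_ln ?posrE //; lra.
have mu0 : 0 <= mu by exact: ln_nat_ge0.
have eK : expR ka = K%:R by rewrite lnK // posrE ltr0n.
have hA : K%:R * mu <= K%:R * ka + pik%:R * mu.
  have := ler_ln_nat (_ : 0 < M ^ K)%N crude; rewrite expn_gt0 M0 => /(_ isT).
  by rewrite lnM_nat ?expn_gt0 ?M0 ?K0 // !lnX_nat.
have pikr : 3 * pik%:R <= K%:R + 7 :> R.
  by move: lepik; rewrite -(ler_nat R) natrM !natrD -natr1; lra.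
have muA : mu <= 37 / 24 * ka by apply: (log_last_term_le Kr) hA pikr => //; exact: ln_nat_ge0.
have lnP : ln (P%:R : R) <= 7 / 4 * (K%:R + 1) * L.
  have := ler_ln_nat (_ : 0 < P ^ 4)%N leP; rewrite expn_gt0 P0 => /(_ isT).
  by rewrite !lnX_nat // natrM -[K.+1%:R]natr1 -/L; lra.
have lnk : ln (K.+1%:R : R) <= ka + L.
  rewrite -lnM ?posrE ?ltr0n // ler_ln ?posrE ?mulr_gt0 ?ltr0n //.
  by rewrite -natr1; lra.
have hB : K%:R * nu <= ln (K.+1%:R : R) + K%:R * ka + ln (P%:R : R) + pis%:R * mu.
  have := ler_ln_nat (_ : 0 < V ^ K)%N fine; rewrite expn_gt0 V0 => /(_ isT).
  by rewrite !lnM_nat ?muln_gt0 ?expn_gt0 ?M0 ?K0 ?P0 // !lnX_nat // -/ka -/mu -/nu.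
have pisr : 3 * pis%:R <= s%:R + 6 :> R.
  by move: lepis; rewrite -(ler_nat R) natrM !natrD.
have s_le : s%:R <= expR (mu / 2).
  rewrite -(@ler_pXn2r _ 2) ?nnegrE ?expR_ge0 // -expRM_natl -natrX.
  rewrite (_ : 2%:R * (mu / 2) = mu); last by field.
  by rewrite lnK ?posrE ?ltr0n // ler_nat.
have e1 : expR L = 2 by rewrite lnK // posrE.
have e12 : expR (12 * L) = 64 * 64 by rewrite -ln4096 lnK // posrE.
have nuB := log_ratio_le Kr L12 ka12 eK e1 e12 mu0 (ler0n _ _) muA pisr s_le lnk lnP hB.
have munu : mu <= nu by exact: ler_ln_nat.
have nu2 : ka + 2 * L <= nu.
  rewrite (_ : ka + 2 * L = ln ((4 * K)%:R : R)); first by rewrite ler_ln_nat // muln_gt0.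
  by rewrite (lnM_nat (a := 2 ^ 2)) // lnX_nat // addrC.
exact: log_ratio_lt4 Kr L12 ka12 eK e1 e12 mu0 (ler0n _ _) munu pisr s_le lnk lnP nu2 nuB hB.
Qed.
End RealPart.

(** * A term with a prime factor exceeding the number of terms *)

Local Open Scope nat_scope.

Lemma leq_common_part q d k m : prime q -> q %| d -> q <= k ->
  q ^ logn q m <= \prod_(0 <= p < k.+1 | prime p && (p %| d)) p ^ logn p m.
Proof.
move=> pq qd qk.
rewrite big_mkcond (bigD1_seq q) ?mem_index_iota ?iota_uniq //= pq qd /=.
apply: leq_pmulr; apply: prodn_cond_gt0 => p _.
by case: ifP => // /andP[pp _]; rewrite expn_gt0 prime_gt0.
Qed.

(** In all cases d^(k-1) times the contribution of the primes dividing d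
    is at least 4^(k-1) / k: for d = 2 and d = 3 this comes from the 2-part and
    the 3-part of (k-1)!. *)
Lemma smooth_ap_fine n d k s : 0 < n -> 1 < d -> coprime n d -> 4 <= k ->
  smooth_ap n d k -> ap n d k.-1 < s.+1 ^ 2 ->
  maxn (ap n d k.-1) (4 * k.-1) ^ k.-1
    <= k * k.-1 ^ k.-1 * primorial k * ap n d k.-1 ^ primepi s.
Proof.
move=> n0 d1 nd k4 sm Ms; have k0 : 0 < k by lia.
have := smooth_ap_bound n0 nd k0 sm.
have := prod_maxlogn_le n0 k0 Ms; set E := \prod_(0 <= p < k.+1 | prime p) _.
set D := \prod_(0 <= p < k.+1 | _ && _) _; set M := ap n d k.-1 => leE leD.
have D0 : 0 < D by apply: prodn_cond_gt0 => p /andP[pp _]; rewrite expn_gt0 prime_gt0.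
suff H : maxn M (4 * k.-1) ^ k.-1 <= k * (M ^ k.-1 * D).
  apply: leq_trans H _; rewrite -!mulnA leq_mul2l; apply/orP; right.
  by apply: leq_trans leD _; rewrite leq_mul2l leE orbT.
have kk : k.-1.+1 = k by lia.
have Md : d * k.-1 <= M by rewrite /M /ap mulnC leq_addl.
have [d4|d4] := leqP 4 d.
  rewrite (maxn_idPl _); last by apply: leq_trans Md; rewrite leq_mul2r d4 orbT.
  by apply: leq_trans (leq_pmulr _ D0) _; apply: leq_pmull.
have [e|e] : d = 2 \/ d = 3 by lia.
  have D2 : 2 ^ logn 2 (k.-1)`! <= D by apply: leq_common_part; rewrite ?e //; lia.
  have := pow2_fact k.-1; rewrite kk => p2.
  apply: leq_trans (_ : (2 * M) ^ k.-1 <= _).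
    rewrite leq_exp2r; last by lia.
    by move: Md; rewrite e; lia.
  rewrite expnMn mulnC mulnCA leq_mul2l; apply/orP; right.
  by apply: leq_trans p2 _; rewrite leq_mul2l D2 orbT.
have D3 : 3 ^ logn 3 (k.-1)`! <= D by apply: leq_common_part; rewrite ?e //; lia.
have := pow43_fact k.-1; rewrite kk => p3.
rewrite -(leq_pmul2l (_ : 0 < 3 ^ k.-1)) ?expn_gt0 // -expnMn.
apply: leq_trans (_ : (4 * M) ^ k.-1 <= _).
  rewrite leq_exp2r; last by lia.
  by move: Md; rewrite e; lia.
rewrite expnMn; apply: leq_trans (leq_mul p3 (leqnn (M ^ k.-1))) _.
rewrite -!mulnA [X in _ <= X]mulnCA leq_mul2l; apply/orP; right.
rewrite leq_mul2l; apply/orP; right.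
by rewrite mulnC leq_mul2l D3 orbT.
Qed.

Lemma sqrt_floor m : exists s, s ^ 2 <= m < s.+1 ^ 2.
Proof.
elim: m => [|m [s /andP[s1 s2]]]; first by exists 0.
have [h|h] := leqP (s.+1 ^ 2) m.+1; last by exists s; rewrite h (leq_trans s1).
by exists s.+1; rewrite h /=; nia.
Qed.

(** The three ranges have different proofs: for k < 34 the crude bound on the
    last term leaves a short list to inspect, for k <= 4096 it leaves d <= 7 and
    chains of primes apply, and beyond it the refined bound with the square root
    of the last term is strong enough. *)
Lemma large_prime_factor (R : realType) n d k :
  0 < n -> 1 < d -> coprime n d -> 4 <= k ->
  exists i p, [/\ i < k, prime p, k < p & p %| ap n d i].
Proof.
move=> n0 d1 nd k4; apply: contrapT => no.
have sm : smooth_ap n d k.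
  move=> i p ik pp pT; rewrite leqNgt; apply/negP => kp.
  by apply: no; exists i, p.
have [k34|k34] := ltnP k 34; first by apply: (@not_smooth_small n d k) sm => //; rewrite k4.
have [k4097|k4097] := ltnP k 4097.
  by apply: (@not_smooth_medium n d k) sm => //; rewrite k34.
have k0 : 0 < k by lia.
have [s /andP[s1 s2]] := sqrt_floor (ap n d k.-1).
apply: (smooth_bounds_contradiction R k4097 (ap_gt0 d n0 k.-1) (primorial_gt0 k)
  (smooth_ap_crude n0 nd k0 sm) (primepi_le k)
  (smooth_ap_fine n0 d1 nd k4 sm s2) (primepi_le s) s1 (leq_maxl _ _) (leq_maxr _ _)
  (primorial_le k)).
Qed.

(** * The explicit abc-conjecture as a product over primes *)

Local Open Scope ring_scope.

Section Poisson.
Variable R : realType.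

(** The quotient of consecutive values of w^w / w! is (1 + 1/w)^w <= e. *)
Lemma expn_self_fact (w : nat) : (0 < w)%N ->
  (w%:R : R) ^+ w <= (w`!)%:R * expR (w%:R - 1).
Proof.
elim: w => [//|[|w] IH] _.
  by rewrite expr1 subrr expR0 mulr1.
have w0 : 0 < w.+1%:R :> R by rewrite ltr0n.
have step : (w.+2%:R : R) ^+ w.+1 <= w.+1%:R ^+ w.+1 * expR 1.
  have -> : (w.+2%:R : R) = w.+1%:R * (1 + w.+1%:R^-1).
    by rewrite mulrDr mulr1 divff ?gt_eqF // natr1.
  rewrite exprMn ler_wpM2l ?exprn_ge0 //.
  have -> : expR 1 = expR (w.+1%:R^-1) ^+ w.+1 :> R.
    by rewrite -expRM_natl divff ?gt_eqF.
  by rewrite lerXn2r ?nnegrE ?expR_ge0 ?addr_ge0 ?invr_ge0 // expR_ge1Dx.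
rewrite exprS factS natrM -mulrA ler_wpM2l //.
apply: le_trans step _; apply: le_trans (ler_wpM2r (expR_ge0 _) (IH isT)) _.
by rewrite -mulrA -expRD -[w.+2%:R]natr1 addrK subrK.
Qed.

(** As a function of x, x^w exp(-x) is largest at x = w. *)
Lemma exp_fact_le (x : R) (w : nat) : 0 <= x -> (0 < w)%N ->
  x ^+ w / (w`!)%:R <= expR (x - 1).
Proof.
move=> x0 w0; have wr : 0 < w%:R :> R by rewrite ltr0n.
rewrite ler_pdivrMr ?ltr0n ?fact_gt0 //.
have h : x <= w%:R * expR (x / w%:R - 1).
  have := expR_ge1Dx (x / w%:R - 1); rewrite addrC subrK => h.
  by have := ler_wpM2l (ltW wr) h; rewrite mulrCA divff ?gt_eqF // mulr1.
apply: le_trans (_ : (w%:R * expR (x / w%:R - 1)) ^+ w <= _).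
  by rewrite lerXn2r ?nnegrE // mulr_ge0 ?expR_ge0.
rewrite exprMn -expRM_natl mulrBr mulr1 mulrCA divff ?gt_eqF // mulr1.
apply: le_trans (ler_wpM2r (expR_ge0 _) (expn_self_fact w0)) _.
by rewrite -mulrA -expRD mulrC (_ : w%:R - 1 + (x - w%:R) = x - 1) //; ring.
Qed.

Lemma expR1_ge : 26 / 10 <= expR (1 : R).
Proof.
(* (17 / 16) ^ 16 > 2.6, by repeated squaring *)
have sq (a b : R) : 0 <= a -> a <= expR b -> a ^+ 2 <= expR (2 * b).
  by move=> a0 ab; rewrite expRM_natl lerXn2r ?nnegrE ?expR_ge0.
have h1 : 17 / 16 <= expR (1 / 16) :> R by have := expR_ge1Dx (1/16 : R); lra.
have h2 : 79 / 70 <= expR (2 * (1 / 16)) :> R.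
  by apply: le_trans (sq _ _ _ h1); lra.
have h4 : 14 / 11 <= expR (2 * (2 * (1 / 16))) :> R.
  by apply: le_trans (sq _ _ _ h2); lra.
have h8 : 34 / 21 <= expR (2 * (2 * (2 * (1 / 16)))) :> R.
  by apply: le_trans (sq _ _ _ h4); lra.
have -> : 1 = 2 * (2 * (2 * (2 * (1 / 16)))) :> R by field.
by apply: le_trans (sq _ _ _ h8); lra.
Qed.
End Poisson.

Local Open Scope nat_scope.

Lemma primes_prodE (F : nat -> nat) m B : 0 < m -> m <= B ->
  \prod_(p <- primes m) F p = \prod_(0 <= p < B.+1 | prime p && (p %| m)) F p.
Proof.
move=> m0 mB; rewrite -[RHS]big_filter; apply: perm_big; apply: uniq_perm.
- exact: primes_uniq.
- by rewrite filter_uniq // iota_uniq.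
move=> p; rewrite mem_filter mem_index_iota mem_primes m0 /=.
have [pm|_] := boolP (p %| m); last by rewrite !andbF.
by rewrite ltnS (leq_trans (dvdn_leq m0 pm) mB) !andbT.
Qed.

Lemma leq_prod_sub (F : nat -> nat) (P Q : pred nat) B : (forall p, prime p -> 0 < F p) ->
  (forall p, prime p -> P p -> Q p) ->
  \prod_(0 <= p < B | prime p && P p) F p <= \prod_(0 <= p < B | prime p && Q p) F p.
Proof.
move=> F0 PQ; rewrite big_mkcond [X in _ <= X]big_mkcond; apply: leq_prod => p _.
have [pp /=|//] := boolP (prime p); have [Pp|_] := boolP (P p); first by rewrite PQ.
by case: ifP => // _; exact: F0.
Qed.

Lemma leq_prod_or (F : nat -> nat) (P Q : pred nat) B : (forall p, prime p -> 0 < F p) ->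
  \prod_(0 <= p < B | prime p && (P p || Q p)) F p <=
  \prod_(0 <= p < B | prime p && P p) F p * \prod_(0 <= p < B | prime p && Q p) F p.
Proof.
move=> F0; rewrite big_mkcond [X in _ <= X * _]big_mkcond [X in _ <= _ * X]big_mkcond.
rewrite -big_split /=; apply: leq_prod => p _.
have [pp /=|//] := boolP (prime p).
by case: (P p); case: (Q p) => //=; rewrite ?muln1 ?mul1n // leq_pmulr ?F0.
Qed.

(** Powers of distinct primes dividing Y have a product dividing Y. *)
Lemma prod_dividing_le (e Y B : nat) (P : pred nat) : 0 < Y -> Y <= B ->
  (forall p, prime p -> P p -> p ^ e %| Y) ->
  \prod_(0 <= p < B.+1 | prime p && P p) p ^ e <= Y.
Proof.
move=> Y0 YB H; rewrite [X in _ <= X](@prod_primes_logn Y B Y0); last first.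
  by move=> p pp pY; apply: leq_trans YB; apply: dvdn_leq.
rewrite big_mkcondr; apply: leq_prod => p pp; case: ifP => Pp.
  by rewrite leq_exp2l ?prime_gt1 // -pfactor_dvdn // H.
by rewrite expn_gt0 prime_gt0.
Qed.

Lemma primes_radical m : 0 < m -> primes (radical m) = primes m.
Proof.
move=> m0; apply: (irr_sorted_eq ltn_trans ltnn (sorted_primes _) (sorted_primes _)) => q.
have r0 : 0 < radical m.
  by rewrite /radical big_seq; apply: prodn_cond_gt0 => p; rewrite mem_primes => /andP[/prime_gt0].
rewrite !mem_primes m0 r0 /=; have [pq /=|//] := boolP (prime q).
apply/idP/idP => [|qm].
  rewrite /radical (primes_prodE (fun p => p) m0 (leqnn m)).
  move=> /(prime_dvd_prod_nat pq)[p [_ _ /andP[pp pm] qp]].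
  by move: qp; rewrite dvdn_prime2 // => /eqP ->.
have qin : q \in primes m by rewrite mem_primes pq m0.
by rewrite /radical (big_rem q) //= dvdn_mulr.
Qed.

Lemma four_cube_omega m : 0 < m ->
  4 ^ omega (radical m) * radical m ^ 3 = \prod_(p <- primes m) (4 * p ^ 3).
Proof.
move=> m0; rewrite /omega primes_radical // big_split /= /radical.
rewrite big_const_seq count_predT iter_muln_1.
by rewrite (big_morph (fun x => x ^ 3) (fun x y => expnMn x y 3) (exp1n 3)).
Qed.

Section ABC.
Variables (R : realType) (abc : explicit_abc R).

(** The two bounds use exp_fact_le at x = ln N and at x = (ln N) / 2; the
    factor 1/e is needed for k = 4 and 6 / 13 bounds 6 / (5 e). *)
Lemma abc_square a b : 0 < a -> 0 < b -> coprime a b -> 2 < a + b ->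
  13 * (a + b) < 6 * radical (a * b * (a + b)) ^ 2 /\
  4 * (a + b) ^ 2 < \prod_(p <- primes (a * b * (a + b))) (4 * p ^ 3).
Proof.
move=> a0 b0 ab c2; set m := a * b * (a + b).
have m0 : 0 < m by rewrite !muln_gt0 a0 b0 addn_gt0 a0.
have cac : coprime a (a + b) by rewrite /coprime gcdnDl.
have cbc : coprime b (a + b) by rewrite /coprime gcdnDr gcdnC.
have := abc a0 b0 ab cac cbc erefl c2; rewrite -/m /= -four_cube_omega //.
set N := radical m; set w := omega N; set c := a + b => H.
have N0 : 0 < N.
  by rewrite /N /radical big_seq; apply: prodn_cond_gt0 => p; rewrite mem_primes => /andP[/prime_gt0].
have w0 : 0 < w.
  rewrite /w /omega primes_radical //; case E : (primes m) => [|//].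
  have m1 : 1 < m by rewrite /m; apply: leq_trans (leq_pmull _ _); rewrite ?muln_gt0 ?a0 //; lia.
  have : pdiv m \in primes m by rewrite mem_primes pdiv_prime // m0 pdiv_dvd.
  by rewrite E.
have Nr : (0 < N%:R :> R)%R by rewrite ltr0n.
have lnN0 : (0 <= ln (N%:R : R))%R by exact: ln_nat_ge0.
have eN : expR (ln (N%:R : R)) = N%:R%R by rewrite lnK ?posrE.
have e1 := expR1_ge R; have e0 : (0 < expR 1 :> R)%R by exact: expR_gt0.
have ei : (expR (- 1) <= 5 / 13 :> R)%R.
  have : (expR (- 1) * expR 1 = 1 :> R)%R by rewrite -expRD addNr expR0.
  have h0 : (0 <= expR (- 1) :> R)%R by exact: expR_ge0.
  by have := ler_wpM2l h0 e1; lra.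
have cr : (0 <= c%:R :> R)%R by [].
split; rewrite -(ltr_nat R).
  have h := exp_fact_le lnN0 w0.
  have : (c%:R < 6 / 5 * N%:R * (N%:R * (5 / 13)) :> R)%R.
    apply: lt_le_trans H _; rewrite ler_wpM2l ?mulr_ge0 //.
    by apply: le_trans h _; rewrite expRD eN ler_wpM2l.
  by rewrite !natrM; lra.
pose x : R := (ln (N%:R : R) / 2)%R.
have x0 : (0 <= x)%R by rewrite /x; lra.
have h := exp_fact_le x0 w0.
have ex : (expR x ^+ 2 = N%:R)%R.
  by rewrite -expRM_natl (_ : 2%:R * x = ln N%:R)%R // /x; field.
have ex0 : (0 <= expR x)%R by exact: expR_ge0.
have w20 : (0 <= 2 ^+ w :> R)%R by rewrite exprn_ge0.
have cle : (c%:R < 6 / 5 * N%:R * (2 ^+ w * (expR x * (5 / 13))))%R.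
  apply: lt_le_trans H _; rewrite ler_wpM2l ?mulr_ge0 //.
  rewrite (_ : ln N%:R ^+ w / w`!%:R = 2 ^+ w * (x ^+ w / w`!%:R))%R; last first.
    by rewrite mulrA -exprMn (_ : 2 * x = ln N%:R)%R // /x; field.
  rewrite ler_wpM2l //; apply: le_trans h _.
  by rewrite expRD ler_wpM2l.
have sq : (c%:R ^+ 2 < (6 / 5 * N%:R * (2 ^+ w * (expR x * (5 / 13)))) ^+ 2)%R.
  by rewrite ltr_pXn2r ?nnegrE // !mulr_ge0.
rewrite natrM [X in (_ * X < _)%R]natrX natrM !natrX; apply: lt_le_trans (_ : 4 * (6 / 5 * N%:R * (2 ^+ w * (expR x * (5 / 13)))) ^+ 2 <= _)%R.
  by rewrite ltr_pM2l.
rewrite (_ : 4%:R ^+ w = (2 ^+ w) ^+ 2 :> R)%R; last first.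
  by rewrite exprAC; congr (_ ^+ _)%R; ring.
set W := (2 ^+ w)%R in w20 *; rewrite !exprMn ex.
have : (0 <= W ^+ 2 * N%:R ^+ 3 :> R)%R by rewrite mulr_ge0 ?exprn_ge0.
by lra.
Qed.
End ABC.

(** * Four terms in harmonic position *)

Lemma weight_gt0 p : prime p -> 0 < 4 * p ^ 3.
Proof. by move/prime_gt0=> p0; rewrite muln_gt0 /= expn_gt0 p0. Qed.

(** Dividing a relation a + b = c by its common factor costs at most g in the
    size of c, while the primes that remain still divide a b c. *)
Lemma abc_gcd (R : realType) (abc : explicit_abc R) a b g B (Q : pred nat) :
  0 < a -> 0 < b -> gcdn a b <= g -> 2 * g < a + b -> a * b * (a + b) <= B ->
  (forall p, prime p -> p %| a * b * (a + b) -> Q p) ->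
  13 * (a + b) < 6 * g * (\prod_(0 <= p < B.+1 | prime p && Q p) p) ^ 2 /\
  4 * (a + b) ^ 2 < g ^ 2 * \prod_(0 <= p < B.+1 | prime p && Q p) (4 * p ^ 3).
Proof.
move=> a0 b0 gle g2 mB HQ.
have g0 : 0 < gcdn a b by rewrite gcdn_gt0 a0.
set a' := a %/ gcdn a b; set b' := b %/ gcdn a b.
have aE : a = a' * gcdn a b by rewrite /a' divnK ?dvdn_gcdl.
have bE : b = b' * gcdn a b by rewrite /b' divnK ?dvdn_gcdr.
have a'0 : 0 < a' by move: a0; rewrite aE muln_gt0 => /andP[].
have b'0 : 0 < b' by move: b0; rewrite bE muln_gt0 => /andP[].
have cop : coprime a' b'.
  rewrite /coprime -(eqn_pmul2r g0) mul1n muln_gcdl -aE -bE //.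
have cE : a + b = (a' + b') * gcdn a b by rewrite mulnDl -aE -bE.
have c2 : 2 < a' + b'.
  rewrite -(ltn_pmul2r g0) -cE; apply: leq_ltn_trans g2.
  by rewrite leq_mul2l gle orbT.
have [h1 h2] := abc_square abc a'0 b'0 cop c2.
set m' := a' * b' * (a' + b') in h1 h2.
have m'0 : 0 < m' by rewrite !muln_gt0 a'0 b'0 addn_gt0 a'0.
have dvm : m' %| a * b * (a + b).
  rewrite cE [in X in _ %| X * _]aE [in X in _ %| _ * X * _]bE /m'.
  apply: dvdn_mul; last exact: dvdn_mulr.
  by apply: dvdn_mul; exact: dvdn_mulr.
have m'B : m' <= B.
  by apply: leq_trans mB; apply: dvdn_leq dvm; rewrite !muln_gt0 a0 b0 addn_gt0 a0.
have sub p : prime p -> p %| m' -> Q p.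
  by move=> pp pm; apply: HQ => //; apply: dvdn_trans dvm.
split.
  rewrite cE mulnA; apply: leq_trans (_ : 6 * radical m' ^ 2 * gcdn a b <= _).
    by rewrite ltn_pmul2r.
  rewrite -mulnA -[X in _ <= X]mulnA leq_mul2l /= mulnC; apply: leq_mul => //.
  rewrite leq_exp2r // /radical (primes_prodE (fun p => p) m'0 m'B).
  by apply: leq_prod_sub => [p /prime_gt0 //|]; exact: sub.
rewrite cE expnMn mulnA; apply: leq_trans (_ : \prod_(p <- primes m') (4 * p ^ 3) * gcdn a b ^ 2 <= _).
  by rewrite ltn_pmul2r // expn_gt0 g0.
rewrite mulnC; apply: leq_mul; first by rewrite leq_exp2r.
rewrite (primes_prodE (fun p => 4 * p ^ 3) m'0 m'B).
apply: leq_prod_sub => [p pp|]; last exact: sub.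
exact: weight_gt0.
Qed.

(** All that the abc argument retains of the equation. *)
Definition powered (n d k l : nat) : Prop :=
  forall i p, i < k -> prime p -> k < p -> p %| ap n d i -> p ^ l %| ap n d i.

Definition rough (k T : nat) (p : nat) : bool := (k < p) && (p %| T).

Lemma rough_prod_le n d k l i B : 0 < n -> powered n d k l -> i < k ->
  ap n d i <= B ->
  (\prod_(0 <= p < B.+1 | prime p && rough k (ap n d i) p) p) ^ l <= ap n d i.
Proof.
move=> n0 pw ik TB.
rewrite (big_morph (fun x => x ^ l) (fun x y => expnMn x y l) (exp1n l)).
apply: prod_dividing_le => //; first exact: ap_gt0.
by move=> p pp /andP[kp pT]; exact: pw.
Qed.

(** A prime p > k costs 4 p^3, that is p^(3 + b/a) when 4^a <= p^b, and
    occurs to the l-th power in the term. *)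
Lemma rough_weight_le n d k l i B a b : 0 < n -> powered n d k l -> i < k ->
  ap n d i <= B -> (forall p, prime p -> k < p -> 4 ^ a <= p ^ b) ->
  (\prod_(0 <= p < B.+1 | prime p && rough k (ap n d i) p) (4 * p ^ 3)) ^ (a * l)
    <= ap n d i ^ (3 * a + b).
Proof.
move=> n0 pw ik TB ab.
have X := rough_prod_le n0 pw ik TB.
set Y := \prod_(_ <= _ < _ | _) _ in X.
apply: leq_trans (_ : (Y ^ l) ^ (3 * a + b) <= _); last first.
  by case: (3 * a + b) => // c; rewrite leq_exp2r.
rewrite -expnM [l * _]mulnC !expnM.
have [->//|l0] := posnP l.
rewrite leq_exp2r // /Y !(big_morph (fun x => x ^ _) (fun x y => expnMn x y _) (exp1n _)).
apply: leq_prod => p /andP[pp /andP[kp _]].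
rewrite expnMn -expnM expnD mulnC leq_mul2l; apply/orP; right.
exact: ab.
Qed.

Definition quad_hit (n d f p : nat) : bool :=
  [|| p %| ap n d f, p %| ap n d (f + 2), p %| ap n d (f + 3) | p %| ap n d (f + 6)].

(** The cost of the primes between 5 and k in the relation at f. *)
Definition quad_weight (n d k f : nat) : nat :=
  \prod_(0 <= p < k.+1 | prime p && ((4 < p) && quad_hit n d f p)) (4 * p ^ 3).

(** 36^2 (4 * 2^3) (4 * 3^3) / 64: the common factor, the primes 2 and 3, and
    the coefficient 4 of the largest member of the relation. *)
Definition quad_const := 2 ^ 5 * 3 ^ 7.

(** The positions 0, 2, 3, 6 form a harmonic quadruple, which is why a
    quadratic form in two of the terms is proportional to the product of the
    others. *)
Lemma harmonic_identity n d f :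
  ap n d f ^ 2 + 3 * (ap n d (f + 2) * ap n d (f + 6)) = 4 * ap n d (f + 3) ^ 2.
Proof. rewrite /ap; lia. Qed.

Lemma gcdn_ap_dvd n d i j : 0 < n -> coprime n d -> i <= j -> gcdn (ap n d i) (ap n d j) %| j - i.
Proof.
move=> n0 nd ij; apply: (dvdn_ap_sub (n := n) (d := d) ij); rewrite ?dvdn_gcdl ?dvdn_gcdr //.
by apply: coprime_dvdl (dvdn_gcdl _ _) _; exact: coprime_ap.
Qed.

Lemma gcdn_expn x z e : 0 < x -> gcdn (x ^ e) (z ^ e) = gcdn x z ^ e.
Proof.
move=> x0; have g0 : 0 < gcdn x z by rewrite gcdn_gt0 x0.
have cop : coprime (x %/ gcdn x z) (z %/ gcdn x z).
  by rewrite /coprime -(eqn_pmul2r g0) mul1n muln_gcdl !divnK ?dvdn_gcdl ?dvdn_gcdr.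
rewrite -{1}(divnK (dvdn_gcdl x z)) -{3}(divnK (dvdn_gcdr x z)) !expnMn -muln_gcdl.
by have /eqP -> := coprimeXl e (coprimeXr e cop); rewrite mul1n.
Qed.

(** A common divisor divides T_f^2 and 4 T_(f+3)^2, and T_f, T_(f+3) have a
    common factor dividing 3. *)
Lemma harmonic_gcd n d f : 0 < n -> coprime n d ->
  gcdn (ap n d f ^ 2) (3 * (ap n d (f + 2) * ap n d (f + 6))) <= 36.
Proof.
move=> n0 nd; set x := ap n d f; set z := ap n d (f + 3).
set y := 3 * _; set g := gcdn _ _.
have gx : g %| x ^ 2 by exact: dvdn_gcdl.
have gz : g %| 4 * z ^ 2 by rewrite -harmonic_identity dvdn_add // dvdn_gcdr.
have h3 : gcdn x z %| 3.
  by have := gcdn_ap_dvd n0 nd (leq_addr 3 f); rewrite addKn.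
have : g %| 36.
  apply: dvdn_trans (_ : 4 * gcdn (x ^ 2) (z ^ 2) %| _).
    by rewrite muln_gcdr dvdn_gcd gz dvdn_mull.
  have -> : gcdn (x ^ 2) (z ^ 2) = gcdn x z ^ 2 by rewrite gcdn_expn // ap_gt0.
  by rewrite (_ : 36 = 4 * 3 ^ 2) // dvdn_mul // dvdn_exp2r.
by move/dvdn_leq; apply.
Qed.

Lemma leq_expn_base a b e : a <= b -> a ^ e <= b ^ e.
Proof. by case: e => // e ab; rewrite leq_exp2r. Qed.

Lemma prod_prime_single (F : nat -> nat) q B : (forall p, prime p -> 0 < F p) -> prime q ->
  \prod_(0 <= p < B | prime p && (p == q)) F p <= F q.
Proof.
move=> F0 pq.
have -> : \prod_(0 <= p < B | prime p && (p == q)) F p = if q < B then F q else 1.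
  elim: B => [|B IH]; first by rewrite big_geq.
  rewrite big_mkcond big_nat_recr //= -big_mkcond /= IH ltnS.
  have [->|ne] := eqVneq B q; first by rewrite pq ltnn leqnn mul1n.
  by rewrite andbF muln1 [in RHS]leq_eqVlt eq_sym (negPf ne).
by case: ifP => // _; exact: F0.
Qed.

Definition rough_weight (k B T : nat) : nat :=
  \prod_(0 <= p < B.+1 | prime p && rough k T p) (4 * p ^ 3).

(** The abc bound for the harmonic relation divided by its common factor.  The
    primes of the radical are kept apart as 2 and 3, those from 5 to k, which
    will be averaged over f, and those above k, which the equation controls
    term by term. *)
Lemma four_term (R : realType) (abc : explicit_abc R) n d k f :
  0 < n -> 1 < d -> coprime n d -> f + 6 < k ->
  exists2 B, ap n d k.-1 <= B &
  ap n d (f + 3) ^ 4 < quad_const * (quad_weight n d k f *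
    (rough_weight k B (ap n d f) * (rough_weight k B (ap n d (f + 2)) *
     (rough_weight k B (ap n d (f + 3)) * rough_weight k B (ap n d (f + 6)))))).
Proof.
move=> n0 d1 nd fk.
set x := ap n d f; set y2 := ap n d (f + 2); set z := ap n d (f + 3); set y6 := ap n d (f + 6).
have x0 : 0 < x by exact: ap_gt0.
have y20 : 0 < y2 by exact: ap_gt0.
have y60 : 0 < y6 by exact: ap_gt0.
have z0 : 0 < z by exact: ap_gt0.
pose a := x ^ 2; pose b := 3 * (y2 * y6).
have abE : a + b = 4 * z ^ 2 by exact: harmonic_identity.
pose B := a * b * (a + b) + ap n d k.-1.
exists B; first exact: leq_addl.
pose Q p := (p == 2) || ((p == 3) || (((p <= k) && ((4 < p) && quad_hit n d f p)) ||
  (rough k x p || (rough k y2 p || (rough k z p || rough k y6 p))))).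
have HQ p : prime p -> p %| a * b * (a + b) -> Q p.
  move=> pp.
  have E u v : (p %| u * v) = (p %| u) || (p %| v) by exact: Euclid_dvdM.
  have EX u e : 0 < e -> (p %| u ^ e) = (p %| u) by move=> e0; rewrite Euclid_dvdX // e0 andbT.
  rewrite abE [_ %| a * b * _]E [_ %| a * b]E [_ %| b]E [_ %| y2 * y6]E [_ %| 4 * _]E !EX //.
  rewrite /Q; have [p4|p4] := leqP p 4.
    have : p \in [:: 2; 3] by clear -pp p4; case: p pp p4 => [|[|[|[|[|p]]]]].
    by rewrite !inE => /orP[] ->; rewrite ?orbT.
  have small q : 0 < q <= 4 -> (p %| q) = false.
    by move=> /andP[q0 q4]; apply/negP => /(dvdn_leq q0); rewrite leqNgt (leq_trans _ p4).
  rewrite (small 3) // (small 4) // !orFb => hit.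
  have {}hit : quad_hit n d f p.
    rewrite /quad_hit -/x -/y2 -/z -/y6; move: hit.
    by case: (p %| x); case: (p %| y2); case: (p %| y6); case: (p %| z).
  rewrite hit /rough; have [pk|kp] := leqP p k; first by rewrite !orbT.
  by move: hit; rewrite /quad_hit -/x -/y2 -/z -/y6 => /or4P[] ->; rewrite !orbT.
have zz : 7 <= z by rewrite /z /ap; nia.
have g2 : 2 * 36 < a + b by rewrite abE; nia.
have a0 : 0 < a by rewrite expn_gt0 x0.
have b0 : 0 < b by rewrite !muln_gt0 y20 y60.
have mB : a * b * (a + b) <= B by exact: leq_addr.
have [_] := abc_gcd abc a0 b0 (harmonic_gcd f n0 nd) g2 mB HQ.
rewrite abE => main.
have F0 := weight_gt0.
have kB : k <= B.
  apply: leq_trans (leq_addl _ _); rewrite /ap; nia.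
have step (P1 P2 : pred nat) u v :
   \prod_(0 <= p < B.+1 | prime p && P1 p) (4 * p ^ 3) <= u ->
   \prod_(0 <= p < B.+1 | prime p && P2 p) (4 * p ^ 3) <= v ->
   \prod_(0 <= p < B.+1 | prime p && (P1 p || P2 p)) (4 * p ^ 3) <= u * v.
  by move=> h1 h2; apply: leq_trans (leq_prod_or _ _ _ F0) (leq_mul h1 h2).
have quadE : \prod_(0 <= p < B.+1 | prime p && ((p <= k) && ((4 < p) && quad_hit n d f p)))
    (4 * p ^ 3) <= quad_weight n d k f.
  rewrite (@big_cat_nat _ _ _ k.+1) //= [X in _ * X]big_nat_cond [X in _ * X]big1 ?muln1.
    by apply: leq_prod_sub => // p pp /andP[].
  by move=> p /andP[/andP[kp _] /and3P[_ pk _]]; move: pk; rewrite leqNgt kp.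
have bound : \prod_(0 <= p < B.+1 | prime p && Q p) (4 * p ^ 3) <=
  4 * 2 ^ 3 * (4 * 3 ^ 3 * (quad_weight n d k f *
    (rough_weight k B x * (rough_weight k B y2 *
     (rough_weight k B z * rough_weight k B y6))))).
  apply: (step); first exact: prod_prime_single.
  apply: (step); first exact: prod_prime_single.
  apply: (step); first exact: quadE.
  by do 3![apply: (step); first exact: leqnn].
move: bound main; set W := quad_weight n d k f * _; set PP := \prod_(_ <= _ < _ | _) _.
move=> bound main; have {main} := leq_trans main (leq_mul (leqnn (36 ^ 2)) bound).
rewrite /quad_const.
have -> : 4 * (4 * z ^ 2) ^ 2 = 64 * z ^ 4 by rewrite expnMn -expnM mulnA.
have cst u v : (u ^ 2 * v ^ 2) ^ 2 * (u ^ 2 * u ^ 3 * (u ^ 2 * v ^ 3 * W))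
    = u ^ 6 * (u ^ 5 * v ^ 7 * W) by lia.
rewrite (_ : 36 = 2 ^ 2 * 3 ^ 2) // {3 4}(_ : 4 = 2 ^ 2) // cst (_ : 64 = 2 ^ 6) //.
by rewrite ltn_pmul2l // expn_gt0.
Qed.

(** The rough parts of the four terms cost at most M^(4 (3a+b)/(a l)).
    Replacing T_(f+3) by (f+3) M / (k-1) and M by (k+1)^l, and extracting a root,
    leaves an inequality in k and the primes up to k alone. *)
Lemma window_inequality (R : realType) (abc : explicit_abc R) n d k l f a b e q :
  0 < n -> 1 < d -> coprime n d -> f + 6 < k -> powered n d k l -> 0 < a * l ->
  (forall p, prime p -> k < p -> 4 ^ a <= p ^ b) -> k.+1 ^ l <= ap n d k.-1 ->
  3 * a + b <= a * l ->
  e * (a * l) <= q * (l * (4 * (a * l - (3 * a + b)))) ->  0 < q ->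
  k.+1 ^ e * (f + 3) ^ (4 * q) < (k.-1 ^ 4 * (quad_const * quad_weight n d k f)) ^ q.
Proof.
move=> n0 d1 nd fk pw al0 ab Mk leab eq q0.
have [B MB four] := four_term abc n0 d1 nd fk.
set M := ap n d k.-1 in MB Mk *.
have M0 : 0 < M by exact: ap_gt0.
set N1 := a * l in al0 leab eq *; set N2 := 3 * a + b in leab eq *.
have rw i : i < k -> rough_weight k B (ap n d i) ^ N1 <= M ^ N2.
  move=> ik; have iM : ap n d i <= M by apply: ap_mono; lia.
  apply: leq_trans (rough_weight_le n0 pw ik (leq_trans iM MB) ab) _.
  exact: leq_expn_base.
set Z := ap n d (f + 3) in four *; set Y := quad_weight n d k f in four *.
have four' : Z ^ (4 * N1) < (quad_const * Y) ^ N1 * M ^ (4 * N2).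
  move: four; rewrite mulnA; set W := rough_weight _ _ _ * _ => four.
  apply: leq_trans (_ : (quad_const * Y * W) ^ N1 <= _).
    by rewrite expnM ltn_exp2r.
  rewrite expnMn leq_mul2l; apply/orP; right.
  rewrite /W !expnMn (_ : 4 * N2 = N2 + (N2 + (N2 + N2))); last by lia.
  rewrite 3!expnD; have r0 := rw f; have r2 := rw (f + 2).
  have r3 := rw (f + 3); have r6 := rw (f + 6).
  apply: leq_mul; first by apply: r0; lia.
  apply: leq_mul; first by apply: r2; lia.
  by apply: leq_mul; [apply: r3; lia | exact: r6].
have ZM : M * (f + 3) <= k.-1 * Z.
  rewrite /M /Z /ap mulnDl [X in _ <= X]mulnDr; apply: leq_add; first by rewrite mulnC leq_mul2r; lia.
  by rewrite -!mulnA leq_mul2l [d * _]mulnC leqnn orbT.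
have h1 : M ^ (4 * (N1 - N2)) * (f + 3) ^ (4 * N1) < (k.-1 ^ 4 * (quad_const * Y)) ^ N1.
  have MN : 0 < M ^ (4 * N2) by rewrite expn_gt0 M0.
  rewrite -(ltn_pmul2r MN) mulnAC -expnD.
  rewrite (_ : 4 * (N1 - N2) + 4 * N2 = 4 * N1); last by lia.
  rewrite -expnMn; apply: leq_ltn_trans (leq_expn_base _ ZM) _.
  rewrite [X in X < _]expnMn [(_ * (quad_const * Y)) ^ N1]expnMn -expnM -mulnA.
  by rewrite ltn_pmul2l // expn_gt0; lia.
rewrite -(ltn_exp2r _ _ al0) expnMn -!expnM.
apply: leq_ltn_trans (_ : (M ^ (4 * (N1 - N2)) * (f + 3) ^ (4 * N1)) ^ q < _); last first.
  by rewrite [q * N1]mulnC [X in _ < X]expnM ltn_exp2r.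
rewrite expnMn -!expnM (_ : 4 * q * N1 = 4 * N1 * q); last by lia.
rewrite leq_mul2r; apply/orP; right.
apply: leq_trans (_ : (k.+1 ^ l) ^ (4 * (N1 - N2) * q) <= _); last exact: leq_expn_base.
rewrite -expnM leq_exp2l; last by lia.
by apply: leq_trans eq _; rewrite mulnC -mulnA.
Qed.

(** * Averaging over all windows *)

(** Two indices of terms divisible by p differ by a multiple of p. *)
Lemma count_ap n d p a m : 0 < n -> coprime n d -> prime p ->
  \sum_(a <= i < a + m) (p %| ap n d i) <= (m.-1 %/ p).+1.
Proof.
move=> n0 nd pp; elim/ltn_ind: m a => m IH a.
case: m IH => [|m] IH; first by rewrite addn0 big_geq.
have p0 := prime_gt0 pp.
rewrite big_ltn; last by rewrite addnS ltnS leq_addr.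
have [pa|npa] /= := boolP (p %| ap n d a); last first.
  rewrite add0n -addSnnS; apply: leq_trans (IH m (ltnSn m) a.+1) _.
  by rewrite ltnS leq_div2r // leq_pred.
have gap i : a < i < a + p -> (p %| ap n d i) = false.
  move=> /andP[ai ip]; apply/negP => pi.
  have cpd : coprime p d.
    by rewrite prime_coprime //; apply: (ap_ndvd nd pp pa).
  have := dvdn_ap_sub (ltnW ai) cpd pa pi.
  by move=> /(dvdn_leq (_ : 0 < i - a)); rewrite subn_gt0 ai => /(_ isT); lia.
have [mp|pm] := leqP m.+1 p.
  rewrite big_nat big1 ?addn0; first by [].
  by move=> i /andP[ai im]; rewrite gap // ai; lia.
rewrite (@big_cat_nat _ _ _ (a + p)) /=; [|lia|lia].
rewrite [X in 1 + (X + _)]big_nat [X in 1 + (X + _)]big1; last first.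
  by move=> i /andP[ai im]; rewrite gap // ai.
have -> : a + m.+1 = (a + p) + (m.+1 - p) by lia.
rewrite add0n addnC addn1 ltnS.
apply: leq_trans (IH (m.+1 - p) _ (a + p)) _; first by lia.
have -> : (m.+1 - p).-1 = m - p by lia.
by rewrite -[in X in _ <= X](subnKC (_ : p <= m)) // divnDl ?divnn ?p0 ?add1n.
Qed.

Definition hit_bound (k p : nat) : nat := minn (k - 6) (4 * (k.-1 %/ p).+1).

(** Exchanging the products, p appears once for each window that it
    hits. *)
Lemma prod_quad_weight n d k : 0 < n -> coprime n d ->
  \prod_(0 <= f < k - 6) quad_weight n d k f <=
  \prod_(0 <= p < k.+1 | prime p && (4 < p)) (4 * p ^ 3) ^ hit_bound k p.
Proof.
move=> n0 nd.
have E f : quad_weight n d k f =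
   \prod_(0 <= p < k.+1 | prime p && (4 < p)) (4 * p ^ 3) ^ quad_hit n d f p.
  rewrite /quad_weight (eq_bigl (fun p => (prime p && (4 < p)) && quad_hit n d f p)); last first.
    by move=> p; rewrite andbA.
  by rewrite big_mkcondr; apply: eq_bigr => p _; case: quad_hit.
rewrite (eq_bigr _ (fun f _ => E f)) exchange_big /=; apply: leq_prod => p /andP[pp p4].
rewrite -(big_morph (expn (4 * p ^ 3)) (expnD _) (expn0 _)).
apply: leq_pexp2l; first exact: weight_gt0.
rewrite /hit_bound leq_min; apply/andP; split.
  apply: leq_trans (_ : \sum_(0 <= f < k - 6) 1 <= _); last by rewrite sum_nat_const_nat muln1 subn0.
  by apply: leq_sum => f _; case: quad_hit.
have shift s : \sum_(0 <= f < k - 6) (p %| ap n d (f + s)) <= (k.-1 %/ p).+1.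
  have := count_ap s (k - 6) n0 nd pp; rewrite -{1}[s]add0n big_addn addKn => le.
  by apply: leq_trans le _; rewrite ltnS leq_div2r //; lia.
apply: leq_trans (_ : \sum_(0 <= f < k - 6) ((p %| ap n d (f + 0)) + ((p %| ap n d (f + 2))
   + ((p %| ap n d (f + 3)) + (p %| ap n d (f + 6))))) <= _).
  apply: leq_sum => f _; rewrite /quad_hit addn0.
  by case: (p %| _); case: (p %| _); case: (p %| _); case: (p %| _).
rewrite !big_split /= (_ : 4 * (k.-1 %/ p).+1 = (k.-1 %/ p).+1 + ((k.-1 %/ p).+1 +
  ((k.-1 %/ p).+1 + (k.-1 %/ p).+1))); last by lia.
by do 3![apply: leq_add; first exact: shift].
Qed.

Lemma ltn_prod_nat R (a b : nat -> nat) : 0 < R -> (forall f, f < R -> a f < b f) ->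
  \prod_(0 <= f < R) a f < \prod_(0 <= f < R) b f.
Proof.
case: R => // R _; elim: R => [|R IH] H; first by rewrite !big_nat1 H.
rewrite big_nat_recr // [X in _ < X]big_nat_recr //=.
apply: ltn_mul; last exact: H.
by apply: IH => f fR; apply: H; apply: ltnW.
Qed.

Lemma windows_product (R : realType) (abc : explicit_abc R) n d k l a b e q :
  0 < n -> 1 < d -> coprime n d -> 7 <= k -> powered n d k l -> 0 < a * l ->
  (forall p, prime p -> k < p -> 4 ^ a <= p ^ b) -> k.+1 ^ l <= ap n d k.-1 ->
  3 * a + b <= a * l ->
  e * (a * l) <= q * (l * (4 * (a * l - (3 * a + b)))) ->  0 < q ->
  k.+1 ^ (e * (k - 6)) * (\prod_(0 <= f < k - 6) (f + 3)) ^ (4 * q) <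
  (k.-1 ^ (4 * (k - 6)) * (quad_const ^ (k - 6) *
    \prod_(0 <= p < k.+1 | prime p && (4 < p)) (4 * p ^ 3) ^ hit_bound k p)) ^ q.
Proof.
move=> n0 d1 nd k7 pw al ab Mk le1 le2 q0.
have R0 : 0 < k - 6 by rewrite subn_gt0.
have H f : f < k - 6 ->
  k.+1 ^ e * (f + 3) ^ (4 * q) < (k.-1 ^ 4 * (quad_const * quad_weight n d k f)) ^ q.
  by move=> fR; apply: (window_inequality abc n0 d1 nd _ pw al ab Mk le1 le2 q0); lia.
have := ltn_prod_nat R0 H; rewrite big_split /= prod_nat_const_nat subn0 -expnM.
rewrite -(big_morph (fun x => x ^ _) (fun x y => expnMn x y _) (exp1n _)) => lt.
apply: leq_trans lt _.
rewrite -(big_morph (fun x => x ^ _) (fun x y => expnMn x y _) (exp1n _)).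
rewrite leq_exp2r // big_split [X in _ * X <= _]big_split /= !prod_nat_const_nat subn0 -expnM.
by rewrite !leq_mul2l prod_quad_weight ?orbT.
Qed.

Definition precision : N := 32%num.
(** log_ub x a and log_lb x a bound the binary logarithm of x by a / 32. *)
Definition log_ub (x a : N) : Prop := N.le (N.pow x precision) (N.pow 2 a).
Definition log_lb (x a : N) : Prop := N.le (N.pow 2 a) (N.pow x precision).

Lemma log_ubM x y a b : log_ub x a -> log_ub y b -> log_ub (N.mul x y) (N.add a b).
Proof. by move=> xa yb; rewrite /log_ub N.pow_mul_l N.pow_add_r; apply: N.mul_le_mono. Qed.

Lemma log_lbM x y a b : log_lb x a -> log_lb y b -> log_lb (N.mul x y) (N.add a b).
Proof. by move=> xa yb; rewrite /log_lb N.pow_mul_l N.pow_add_r; apply: N.mul_le_mono. Qed.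

Lemma log_ubX x a e : log_ub x a -> log_ub (N.pow x e) (N.mul a e).
Proof.
move=> xa; rewrite /log_ub -N.pow_mul_r [N.mul e _]N.mul_comm N.pow_mul_r N.pow_mul_r.
exact: N.pow_le_mono_l.
Qed.

Lemma log_lbX x a e : log_lb x a -> log_lb (N.pow x e) (N.mul a e).
Proof.
move=> xa; rewrite /log_lb -N.pow_mul_r [N.mul e _]N.mul_comm N.pow_mul_r N.pow_mul_r.
exact: N.pow_le_mono_l.
Qed.

Lemma log_ub_prod (A : Type) (F G : A -> N) (s : seq A) : (forall x, log_ub (F x) (G x)) ->
  log_ub (foldr (fun x => N.mul (F x)) 1%num s) (foldr (fun x => N.add (G x)) 0%num s).
Proof.
move=> H; elim: s => [|x s IH] /=; last exact: log_ubM.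
by rewrite /log_ub N.pow_1_l; exact: N.le_refl.
Qed.

Lemma log_lb_prod (A : Type) (F G : A -> N) (s : seq A) : (forall x, log_lb (F x) (G x)) ->
  log_lb (foldr (fun x => N.mul (F x)) 1%num s) (foldr (fun x => N.add (G x)) 0%num s).
Proof.
move=> H; elim: s => [|x s IH] /=; last exact: log_lbM.
by rewrite /log_lb N.pow_1_l; exact: N.le_refl.
Qed.

Lemma log_le x y a b : log_ub x a -> log_lb y b -> N.leb a b -> N.le x y.
Proof.
move=> xa yb /N.leb_spec0 ab; apply/(N.pow_le_mono_l_iff _ _ precision) => //.
apply: N.le_trans xa _; apply: N.le_trans yb.
exact: N.pow_le_mono_r.
Qed.

Definition logN (x : nat) : N := N.log2 (N.pow (N.of_nat x) precision).

Lemma logN_ub x : log_ub (N.of_nat x) (N.succ (logN x)).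
Proof.
rewrite /log_ub /logN; case: x => [|x]; first by [].
apply: N.lt_le_incl; apply: (proj2 (N.log2_spec _ _)).
have : (N.of_nat x.+1 <> 0)%num by [].
by move=> ne; have := N.pow_nonzero _ precision ne; lia.
Qed.

Lemma logN_lb x : log_lb (N.of_nat x.+1) (logN x.+1).
Proof.
rewrite /log_lb /logN; apply: (proj1 (N.log2_spec _ _)).
have : (N.of_nat x.+1 <> 0)%num by [].
by move=> ne; have := N.pow_nonzero _ precision ne; lia.
Qed.

Definition window_check (k : nat) : bool :=
  let R := N.of_nat (k - 6) in
  N.leb
   (N.add (N.mul (N.succ (logN k.-1)) (N.of_nat (4 * (k - 6))))
     (N.add (N.mul (N.add (N.mul (N.succ (logN 2)) 5) (N.mul (N.succ (logN 3)) 7)) R)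
       (foldr (fun p => N.add (N.mul (N.add (N.succ (logN 4)) (N.mul (N.succ (logN p)) 3))
            (N.of_nat (hit_bound k p)))) 0%num
          [seq p <- index_iota 0 k.+1 | prime p && (4 < p)])))
   (N.add (N.mul (logN k.+1) (N.of_nat (17 * (k - 6))))
     (N.mul (foldr (fun f => N.add (logN f.+3)) 0%num (index_iota 0 (k - 6))) 4)).

Lemma window_check_all : all window_check (iota 7 121).
Proof. by vm_compute. Qed.

Lemma N_of_prod (F : nat -> nat) s :
  N.of_nat (\prod_(p <- s) F p) = foldr (fun p => N.mul (N.of_nat (F p))) 1%num s.
Proof. by elim: s => [|p s IH]; rewrite ?big_nil // big_cons N_of_muln IH. Qed.

(** Checked on the integer parts of 32 log_2; the inequality has enough
    room for this rounding. *)
Lemma window_finite k : 7 <= k < 128 ->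
  k.-1 ^ (4 * (k - 6)) * (quad_const ^ (k - 6) *
    \prod_(0 <= p < k.+1 | prime p && (4 < p)) (4 * p ^ 3) ^ hit_bound k p)
  <= k.+1 ^ (17 * (k - 6)) * (\prod_(0 <= f < k - 6) (f + 3)) ^ 4.
Proof.
move=> k7; have /allP/(_ k) := window_check_all; rewrite mem_iota => /(_ k7).
rewrite /window_check => chk; rewrite -N_of_leq -big_filter; apply/N.leb_spec0.
apply: log_le chk.
  rewrite [N.of_nat (k.-1 ^ _ * _)]N_of_muln [N.of_nat (quad_const ^ _ * _)]N_of_muln N_of_prod.
  apply: log_ubM; first by rewrite N_of_expn; apply: log_ubX; exact: logN_ub.
  apply: log_ubM.
    rewrite N_of_expn /quad_const N_of_muln; apply: log_ubX; apply: log_ubM; rewrite N_of_expn; apply: log_ubX; exact: logN_ub.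
  apply: log_ub_prod => p; rewrite N_of_expn N_of_muln N_of_expn.
  by apply: log_ubX; apply: log_ubM; [exact: logN_ub | apply: log_ubX; exact: logN_ub].
rewrite [N.of_nat (k.+1 ^ _ * _)]N_of_muln.
apply: log_lbM; first by rewrite N_of_expn; apply: log_lbX; exact: logN_lb.
rewrite N_of_expn N_of_prod; apply: log_lbX; apply: log_lb_prod => f.
by rewrite addn3; exact: logN_lb.
Qed.

(** * Estimates for the averaged inequality *)

(** The exponent of 3 is at least [m/3] + [m/9]. *)
Lemma logn3_fact_ge m : 4 * m <= 9 * logn 3 m`! + 14.
Proof.
have mono a b : a <= b -> logn 3 a`! <= logn 3 b`!.
  by move=> ab; apply: dvdn_leq_log; rewrite ?fact_gt0 // dvdn_fact_fact.
have third a : a %/ 3 <= logn 3 a`! - logn 3 (a %/ 3)`!.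
  have := mono (3 * (a %/ 3)) a _; rewrite logn3_fact_triple => /(_ ltac:(lia)); lia.
have h1 := third m; have h2 := third (m %/ 3); lia.
Qed.

(** The exponent (k-1)/p + 1 bounds the number of terms divisible by p. *)
Definition ceil_prod (k : nat) : nat :=
  \prod_(0 <= p < k.+1 | prime p && (4 < p)) p ^ (k.-1 %/ p).+1.

(** For each prime p the exponent of p in (k-1)! is at least (k-1)/p, and
    primorial k supplies the additional 1.  The primes 2 and 3, absent on the left,
    are kept as a gain. *)
Lemma ceil_prod_le k : 5 <= k ->
  ceil_prod k * (2 ^ (logn 2 (k.-1)`!).+1 * 3 ^ (logn 3 (k.-1)`!).+1)
    <= (k.-1)`! * primorial k.
Proof.
move=> k5; have km0 : 0 < k.-1 by lia.
have fE : (k.-1)`! = \prod_(0 <= p < k.+1 | prime p) p ^ logn p (k.-1)`!.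
  apply: prod_primes_logn => [|p pp]; first exact: fact_gt0.
  rewrite fact_prod => /(prime_dvd_prod_nat pp)[i [i1 ik _ pi]].
  by have := dvdn_leq i1 pi; lia.
pose F p := p ^ (if 4 < p then k.-1 %/ p else logn p (k.-1)`!).+1.
apply: leq_trans (_ : \prod_(0 <= p < k.+1 | prime p) F p <= _); last first.
  rewrite [X in _ <= X * _]fE /primorial -big_split /=; apply: leq_prod => p pp.
  rewrite -expnSr leq_pexp2l ?prime_gt0 // ltnS; case: ifP => // _.
  by rewrite logn_fact // big_ltn ?expn1 ?leq_addr // ltnS.
have k5' : 5 <= k.+1 by lia.
rewrite /ceil_prod (@big_cat_nat _ _ _ 5) // [X in _ <= X](@big_cat_nat _ _ _ 5) //=.
set T := \prod_(5 <= p < k.+1 | _) _; set U := \prod_(5 <= p < k.+1 | _) _.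
have -> : T = U.
  rewrite /T /U big_nat_cond [RHS]big_nat_cond; apply: eq_big => p.
    by case: (boolP (5 <= p < k.+1)) => // /andP[-> _]; rewrite andbT.
  by move=> /andP[/andP[p5 _] _]; rewrite /F p5.
by rewrite !unlock /= /F /= mul1n muln1 mulnC.
Qed.

Lemma prod_shift3 m : \prod_(0 <= f < m) (f + 3) * 2 = (m + 2)`!.
Proof.
elim: m => [|m IH]; first by rewrite big_geq.
by rewrite big_nat_recr //= mulnAC IH addn3 mulnC addSn factS addn2.
Qed.

Lemma fact_le_shift k : 6 <= k ->
  (k.-1)`! <= 2 * \prod_(0 <= f < k - 6) (f + 3) * k ^ 3.
Proof.
move=> k6; rewrite [2 * _]mulnC prod_shift3.
have [m e] : exists m, k = m + 6 by exists (k - 6); lia.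
have -> : k.-1 = m.+4.+1 by lia.
have -> : k - 6 + 2 = m.+2 by lia.
have fE : (m.+4.+1)`! = m.+2`! * (m.+4.+1 * (m.+4 * m.+3)).
  by rewrite (factS m.+4) (factS m.+3) (factS m.+2) [in LHS]mulnA [in LHS]mulnA mulnC -mulnA.
rewrite fE leq_mul2l; apply/orP; right.
have k3 : k ^ 3 = k * (k * k) by rewrite !expnS muln1.
by rewrite k3; do 2?[apply: leq_mul]; lia.
Qed.

(** For p >= 5 one has 4^8 <= p^7, hence (4 p^3)^8 <= p^31. *)
Lemma window_weight_le k :
  (\prod_(0 <= p < k.+1 | prime p && (4 < p)) (4 * p ^ 3) ^ hit_bound k p) ^ 2
    <= ceil_prod k ^ 31.
Proof.
rewrite /ceil_prod !(big_morph (fun x => x ^ _) (fun x y => expnMn x y _) (exp1n _)).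
apply: leq_prod => p /andP[pp p4]; set h := (k.-1 %/ p).+1.
have c47 : 4 ^ 8 <= p ^ 7.
  by apply: leq_trans (_ : 5 ^ 7 <= _); [apply: leq_expn_N; vm_compute | rewrite leq_exp2r].
have w : (4 * p ^ 3) ^ 8 <= p ^ 31.
  by rewrite expnMn -expnM (_ : 31 = 7 + 3 * 8) // expnD leq_mul2r c47 orbT.
apply: leq_trans (_ : ((4 * p ^ 3) ^ (4 * h)) ^ 2 <= _).
  by rewrite leq_exp2r // leq_pexp2l ?weight_gt0 // /hit_bound geq_minr.
rewrite -expnM (_ : 4 * h * 2 = 8 * h); last by lia.
rewrite expnM; apply: leq_trans (_ : (p ^ 31) ^ h <= _); first by rewrite leq_exp2r.
by rewrite -!expnM mulnC.
Qed.

Local Open Scope ring_scope.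

Section RealEstimates.
Variable R : realType.

Lemma ln2_le : ln (2 : R) <= 3 / 4.
Proof.
rewrite -(expRK (3/4)) ler_ln ?posrE ?expR_gt0 //.
have h : 23 / 20 <= expR (3 / 20) :> R by have := expR_ge1Dx (3/20 : R); lra.
have p0 : 0 <= 23 / 20 :> R by lra.
have -> : expR (3 / 4) = expR (3 / 20) ^+ 5 :> R by rewrite -expRM_natl; congr expR; field.
by apply: le_trans (lerXn2r 5 _ _ h); rewrite ?nnegrE ?expR_ge0 //; lra.
Qed.

Lemma ln3_le : ln (3 : R) <= 3 / 2.
Proof.
apply: le_trans (_ : ln (2 * 2 : R) <= _); first by rewrite ler_ln ?posrE //; lra.
by rewrite lnM ?posrE //; have := ln2_le; lra.
Qed.

(** The step from k to k+1 is ln k <= ln (k+1) - 1/(k+1). *)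
Lemma ln_fact_le k : (0 < k)%N ->
  ln ((k.-1)`!%:R : R) <= k%:R * ln k%:R - k%:R + 1.
Proof.
elim: k => [//|[|k] IH] _; first by rewrite fact0 ln1; lra.
rewrite /= factS lnM_nat ?fact_gt0 //; have {IH} := IH isT; rewrite /= => IH.
set x : R := k.+1%:R in IH *; set y : R := k.+2%:R.
have xy : y = x + 1 by rewrite /y -natr1.
have x1 : 1 <= x by rewrite ler1n.
have step : ln x <= ln y - y^-1.
  have -> : ln x = ln y + ln (1 + - y^-1).
    rewrite -lnM ?posrE; [congr ln; rewrite xy; field | | ]; try lra.
    by rewrite subr_gt0 invf_lt1; lra.
  rewrite lerD2l; apply: le_ln1Dx.
  by rewrite ltrN2 invf_lt1; lra.
have : y * ln x <= y * ln y - 1.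
  have y0 : 0 <= y by lra.
  have := ler_wpM2l y0 step; rewrite mulrBr divff //; lra.
by rewrite xy in step *; lra.
Qed.

Lemma window_numeric (k e la F Q L L3 : R) :
  0 <= la -> 1 / 2 <= L -> L <= 3 / 4 -> 0 <= L3 -> L3 <= 3 / 2 ->
  F <= k * la - k + 1 ->
  Q <= F + 3 / 4 * k * L + la - 4 / 9 * k * L3 + L3 ->
  (k - 6) * e * la + 4 * (F - 3 * la - L) <=
    (k - 6) * (4 * la + 5 * L + 7 * L3) + 31 / 2 * Q -> 0 <= k ->
  (k - 6) * (e - 4) * la <= 23 / 2 * k * la + 28 * la + 6 / 5 * k + 40.
Proof.
move=> la0 L12 L34 L30 L332 hF hQ H k0.
have kL : k * L <= k * (3 / 4) by rewrite ler_wpM2l.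
have kL3 : k * L3 <= k * (3 / 2) by rewrite ler_wpM2l.
lra.
Qed.
End RealEstimates.

Lemma ceil_prod_log_combine (R : realType) (k Q F P v2 v3 la L L3 : R) :
  4 * P <= 7 * k * L -> 4 * (k - 1) <= 9 * v3 + 14 -> 0 <= L3 ->
  Q + ((v2 + 1) * L + (v3 + 1) * L3) <= F + P ->
  (k - 1) * L <= la + v2 * L ->
  Q <= F + 3 / 4 * k * L + la - 4 / 9 * k * L3 + L3.
Proof. by move=> hP hv L30 hQ h2; have := ler_wpM2r L30 hv; lra. Qed.

Lemma window_rescale (R : realType) (e q m la F S W Q L L3 : R) : 0 < q ->
  F <= L + S + 3 * la -> 2 * W <= 31 * Q ->
  e * m * la + 4 * q * S <= q * (4 * m * la + (m * (5 * L + 7 * L3) + W)) ->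
  m * (e / q) * la + 4 * (F - 3 * la - L) <= m * (4 * la + 5 * L + 7 * L3) + 31 / 2 * Q.
Proof.
move=> q0 hF hW H.
have : m * (e / q) * la + 4 * S <= 4 * m * la + (m * (5 * L + 7 * L3) + W).
  rewrite -(ler_pM2l q0).
  by rewrite (_ : q * (m * (e / q) * la + 4 * S) = e * m * la + 4 * q * S) //; field; rewrite gt_eqF.
lra.
Qed.

Lemma monotone_swap (R : realType) (e q m la l1 l2 s c w : R) :
  la <= l1 -> l2 <= la -> 0 <= m -> 0 <= e -> 0 <= q ->
  e * m * l1 + 4 * q * s <= q * (4 * m * l2 + (m * c + w)) ->
  e * m * la + 4 * q * s <= q * (4 * m * la + (m * c + w)).
Proof.
move=> h1 h2 m0 e0 q0; have := ler_wpM2l (mulr_ge0 e0 m0) h1.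
have := ler_wpM2l (mulr_ge0 q0 m0) h2; lra.
Qed.

(** The logarithm of windows_product, with exponent e/q on k+1.  The
    dominant terms are (k-6)(e/q - 4) ln k and (31/2 - 4) k ln k, so that it is
    contradictory for e/q > 31/2 and k large enough. *)
Lemma window_log_bound (R : realType) (k e q : nat) : (128 <= k)%N -> (0 < q)%N ->
  (k.+1 ^ (e * (k - 6)) * (\prod_(0 <= f < k - 6) (f + 3)) ^ (4 * q) <
  (k.-1 ^ (4 * (k - 6)) * (quad_const ^ (k - 6) *
    \prod_(0 <= p < k.+1 | prime p && (4 < p)) (4 * p ^ 3) ^ hit_bound k p)) ^ q)%N ->
  (k%:R - 6) * (e%:R / q%:R - 4) * ln k%:R
   <= 23 / 2 * k%:R * ln k%:R + 28 * ln k%:R + 6 / 5 * k%:R + 40 :> R.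
Proof.
move=> k128 q0; have kS := window_weight_le k.
set S := (\prod_(0 <= f < k - 6) (f + 3))%N.
set W := (\prod_(0 <= p < k.+1 | _) _)%N in kS *.
have k0 : (0 < k)%N by lia.
have S0 : (0 < S)%N by rewrite prodn_gt0 // => f; rewrite addn3.
have W0 : (0 < W)%N by apply: prodn_cond_gt0 => p /andP[pp _]; rewrite expn_gt0 weight_gt0.
have Q0 : (0 < ceil_prod k)%N by apply: prodn_cond_gt0 => p /andP[pp _]; rewrite expn_gt0 prime_gt0.
have C0 : (0 < quad_const)%N by rewrite muln_gt0 !expn_gt0.
have km0 : (0 < k.-1)%N by lia.
move=> /ltnW lt.
set la : R := ln k%:R; pose L : R := ln 2; pose L3 : R := ln 3.
pose F : R := ln (k.-1)`!%:R; pose Q : R := ln (ceil_prod k)%:R.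
have la0 : 0 <= la by exact: ln_nat_ge0.
have lnC : ln (quad_const%:R : R) = 5 * L + 7 * L3.
  by rewrite /quad_const lnM_nat ?expn_gt0 // !lnX_nat.
have hW : 2 * ln (W%:R : R) <= 31 * Q.
  have W20 : (0 < W ^ 2)%N by rewrite expn_gt0 W0.
  by have := ler_ln_nat R W20 kS; rewrite !lnX_nat.
have hS : F <= L + ln (S%:R : R) + 3 * la.
  have := ler_ln_nat R (fact_gt0 _) (fact_le_shift (_ : (6 <= k)%N)).
  rewrite -/S lnM_nat ?muln_gt0 ?expn_gt0 ?S0 ?k0 // lnM_nat // lnX_nat //.
  by apply; lia.
have main : e%:R * (k%:R - 6) * la + 4 * q%:R * ln (S%:R : R) <=
   q%:R * (4 * (k%:R - 6) * la + ((k%:R - 6) * (5 * L + 7 * L3) + ln (W%:R : R))).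
  have lhs0 : (0 < k.+1 ^ (e * (k - 6)) * S ^ (4 * q))%N by rewrite muln_gt0 !expn_gt0 S0.
  have := ler_ln_nat R lhs0 lt.
  rewrite lnM_nat ?expn_gt0 ?S0 // !lnX_nat ?muln_gt0 ?expn_gt0 ?W0 ?C0 ?km0 //.
  rewrite !lnM_nat ?muln_gt0 ?expn_gt0 ?W0 ?C0 ?km0 // !lnX_nat // lnC.
  rewrite !natrM natrB; last by lia.
  have h1 : la <= ln (k.+1%:R : R) by apply: ler_ln_nat.
  have h2 : ln (k.-1%:R : R) <= la by apply: ler_ln_nat => //; lia.
  have k6 : 0 <= k%:R - 6 :> R by rewrite subr_ge0 ler_nat; lia.
  exact: monotone_swap h1 h2 k6 (ler0n _ _) (ler0n _ _).
have hQ : Q <= F + 3 / 4 * k%:R * L + la - 4 / 9 * k%:R * L3 + L3.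
  have fact0 : (0 < (k.-1)`!)%N by exact: fact_gt0.
  have P0 := primorial_gt0 k.
  have k5 : (5 <= k)%N by lia.
  have lhs0 : (0 < ceil_prod k * (2 ^ (logn 2 (k.-1)`!).+1 * 3 ^ (logn 3 (k.-1)`!).+1))%N.
    by rewrite !muln_gt0 Q0 !expn_gt0.
  have := ler_ln_nat R lhs0 (ceil_prod_le k5).
  rewrite !lnM_nat ?muln_gt0 ?expn_gt0 // !lnX_nat // -/Q -/F -/L -/L3 => h1.
  have := ler_ln_nat R (_ : 0 < primorial k ^ 4)%N (primorial_le k).
  rewrite expn_gt0 P0 !lnX_nat // natrM -/L => /(_ isT) h2.
  have := ler_ln_nat R (_ : 0 < 2 ^ k.-1)%N (pow2_fact k.-1).
  rewrite (prednK k0) lnM_nat ?expn_gt0 // !lnX_nat // -/la -/L => /(_ isT) h3.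
  have h4 : 4 * (k%:R - 1) <= 9 * (logn 3 (k.-1)`!)%:R + 14 :> R.
    by have := logn3_fact_ge k.-1; rewrite -(ler_nat R) natrD !natrM -subn1 natrB.
  have h5 : k.-1%:R = k%:R - 1 :> R by rewrite -subn1 natrB.
  have L30 : 0 <= L3 by exact: ln_nat_ge0.
  move: h1 h3; rewrite h5 -[(logn 2 _).+1%:R]natr1 -[(logn 3 _).+1%:R]natr1.
  move=> h1 h3; exact: (ceil_prod_log_combine h2 h4 L30 h1 h3).
have qr : 0 < q%:R :> R by rewrite ltr0n.
apply: (@window_numeric R k%:R _ la F Q L L3) => //.
- exact: ln2_ge.
- exact: ln2_le.
- exact: ln_nat_ge0.
- exact: ln3_le.
- exact: ln_fact_le.
- exact: window_rescale qr hS hW main.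
Qed.

(** * The equation, and the case of four or five terms *)

Local Open Scope nat_scope.

(** A prime p > k divides at most one of the k terms, so its exponent
    there is l times its exponent in y. *)
Lemma powered_of_product n d k b y l : 0 < n -> coprime n d -> 0 < b -> 0 < y ->
  max_pdiv b <= k -> \prod_(0 <= i < k) ap n d i = b * y ^ l -> powered n d k l.
Proof.
move=> n0 nd b0 y0 bk E i p ik pp kp pT.
have cpd : coprime p d by rewrite prime_coprime // (ap_ndvd nd pp pT).
have other j : j < k -> j != i -> logn p (ap n d j) = 0.
  move=> jk ji; apply/eqP; rewrite -leqn0 leqNgt logn_gt0 mem_primes pp ap_gt0 //=.
  apply/negP => pj; have [h|h] : i < j \/ j < i by lia.
    have := dvdn_ap_sub (ltnW h) cpd pT pj.
    by move/(dvdn_leq (_ : 0 < j - i)); rewrite subn_gt0 h => /(_ isT); lia.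
  have := dvdn_ap_sub (ltnW h) cpd pj pT.
  by move/(dvdn_leq (_ : 0 < i - j)); rewrite subn_gt0 h => /(_ isT); lia.
have e1 : logn p (\prod_(0 <= j < k) ap n d j) = logn p (ap n d i).
  rewrite logn_prod_pos; last by move=> j _; exact: ap_gt0.
  rewrite (bigD1_seq i) ?mem_index_iota ?iota_uniq //= big_seq_cond big1 ?addn0 //.
  by move=> j; rewrite mem_index_iota => /andP[/andP[_ jk] ji]; exact: other.
have pb : logn p b = 0.
  apply/eqP; rewrite -leqn0 leqNgt logn_gt0; apply/negP => pb.
  by have := max_pdiv_max pb; lia.
have T0 : 0 < ap n d i by exact: ap_gt0.
have v0 : 0 < logn p (ap n d i) by rewrite logn_gt0 mem_primes pp T0.
move: e1; rewrite E lognM ?expn_gt0 ?y0 // pb add0n lognX => e1.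
rewrite pfactor_dvdn // -e1 leq_pmulr //.
by move: v0; rewrite -e1 muln_gt0 => /andP[].
Qed.

Lemma powered_leq n d k l m : m <= l -> powered n d k l -> powered n d k m.
Proof.
move=> ml pw i p ik pp kp pT; apply: dvdn_trans (pw i p ik pp kp pT).
exact: dvdn_exp2l.
Qed.

Lemma last_term_ge (R : realType) n d k l N : 0 < n -> 1 < d -> coprime n d -> 4 <= k ->
  powered n d k l -> (forall p, prime p -> k < p -> N <= p) -> N ^ l <= ap n d k.-1.
Proof.
move=> n0 d1 nd k4 pw HN.
have [i [p [ik pp kp pT]]] := large_prime_factor R n0 d1 nd k4.
apply: leq_trans (_ : p ^ l <= _); first exact/leq_expn_base/HN.
apply: leq_trans (dvdn_leq (ap_gt0 _ n0 _) (pw i p ik pp kp pT)) _.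
by apply: ap_mono; lia.
Qed.

(** Two of the terms and g bound everything: the radical is at most 6 times the
    rough parts, whose eighth powers are at most the terms. *)
Lemma three_term (R : realType) (abc : explicit_abc R) n d k u v w al be ga g :
  0 < n -> coprime n d -> powered n d k 8 -> u < k -> v < k -> w < k ->
  0 < al <= 3 -> 0 < be <= 3 -> 0 < ga <= 3 ->
  al * ap n d u + be * ap n d v = ga * ap n d w ->
  gcdn (al * ap n d u) (be * ap n d v) <= g -> 2 * g < ga * ap n d w ->
  (forall p, prime p -> 3 < p <= k ->
     [&& ~~ (p %| ap n d u), ~~ (p %| ap n d v) & ~~ (p %| ap n d w)]) ->
  (13 * ga * ap n d w) ^ 4 < (216 * g) ^ 4 * (ap n d u * ap n d v * ap n d w).
Proof.
move=> n0 nd pw uk vk wk al3 be3 ga3 E gle g2 nomid.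
have /andP[al0 _] := al3; have /andP[be0 _] := be3.
set x := ap n d u in E gle nomid *; set y := ap n d v in E gle nomid *.
set z := ap n d w in E g2 nomid *.
have x0 : 0 < x by exact: ap_gt0.
have y0 : 0 < y by exact: ap_gt0.
have z0 : 0 < z by exact: ap_gt0.
pose a := al * x; pose b := be * y.
pose B := a * b * (a + b) + (x + y + z).
pose Q p := (p == 2) || ((p == 3) || (rough k x p || (rough k y p || rough k z p))).
have small c p : prime p -> 0 < c <= 3 -> p %| c -> (p == 2) || (p == 3).
  move=> pp /andP[c0 c3] /(dvdn_leq c0) pc.
  have : p <= 3 by apply: leq_trans pc c3.
  by clear -pp; case: p pp => [|[|[|[|p]]]].
have HQ p : prime p -> p %| a * b * (a + b) -> Q p.
  move=> pp; have EE s t : (p %| s * t) = (p %| s) || (p %| t) by exact: Euclid_dvdM.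
  rewrite [a + b]E [_ %| a * b * _]EE [_ %| a * b]EE [_ %| a]EE [_ %| b]EE [_ %| ga * _]EE.
  rewrite /Q; have [p3|p3] := boolP ((p == 2) || (p == 3)).
    by move: p3 => /orP[] ->; rewrite ?orbT.
  have nd3 c : 0 < c <= 3 -> (p %| c) = false.
    by move=> c3; apply/negP => pc; have := small c p pp c3 pc; rewrite (negPf p3).
  rewrite (nd3 al) // (nd3 be) // (nd3 ga) //= => hit.
  have p4 : 3 < p by clear -pp p3; case: p pp p3 => [|[|[|[|p]]]].
  have kp : k < p.
    rewrite ltnNge; apply/negP => pk; have := nomid p pp; rewrite p4 pk => /(_ isT).
    by move: hit; case: (p %| x); case: (p %| y); case: (p %| z).
  by rewrite /rough kp /=; move: hit; rewrite -orbA => ->; rewrite !orbT.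
have a0 : 0 < a by rewrite muln_gt0 al0.
have b0 : 0 < b by rewrite muln_gt0 be0.
have g2' : 2 * g < a + b by rewrite [a + b]E.
have [main _] := abc_gcd abc a0 b0 gle g2' (leq_addr _ _ : a * b * (a + b) <= B) HQ.
pose X T := \prod_(0 <= p < B.+1 | prime p && rough k T p) p.
have F0 p : prime p -> 0 < p by exact: prime_gt0.
have step (P1 P2 : pred nat) s t :
   \prod_(0 <= p < B.+1 | prime p && P1 p) p <= s ->
   \prod_(0 <= p < B.+1 | prime p && P2 p) p <= t ->
   \prod_(0 <= p < B.+1 | prime p && (P1 p || P2 p)) p <= s * t.
  by move=> h1 h2; apply: leq_trans (leq_prod_or _ _ _ F0) (leq_mul h1 h2).
have bound : \prod_(0 <= p < B.+1 | prime p && Q p) p <= 2 * (3 * (X x * (X y * X z))).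
  apply: (step); first exact: (prod_prime_single (F := id)).
  apply: (step); first exact: (prod_prime_single (F := id)).
  by do 2![apply: (step); first exact: leqnn].
have Xle i : i < k -> ap n d i <= B -> X (ap n d i) ^ 8 <= ap n d i.
  by move=> ik TB; apply: rough_prod_le n0 pw ik TB.
have Xx : X x ^ 8 <= x by apply: Xle => //; rewrite /B -/x; lia.
have Xy : X y ^ 8 <= y by apply: Xle => //; rewrite /B -/y; lia.
have Xz : X z ^ 8 <= z by apply: Xle => //; rewrite /B -/z; lia.
set Y := X x * (X y * X z) in bound.
have Y8 : Y ^ 8 <= x * y * z.
  by rewrite /Y !expnMn -mulnA leq_mul // leq_mul.
have main2 : 13 * ga * z < 216 * g * Y ^ 2.
  rewrite -mulnA -[ga * z]E; apply: leq_trans main _.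
  apply: leq_trans (leq_mul (leqnn (6 * g)) (_ : _ <= (2 * (3 * Y)) ^ 2)) _.
    by rewrite leq_exp2r.
  by rewrite [2 * (3 * Y)]mulnA expnMn mulnA leq_mul2r; apply/orP; right; lia.
apply: leq_trans (_ : (216 * g * Y ^ 2) ^ 4 <= _); first by rewrite ltn_exp2r.
by rewrite [(216 * g * Y ^ 2) ^ 4]expnMn leq_mul2l -expnM Y8 orbT.
Qed.

Lemma three_term_contra c D e r N M x y z :
  (c * z) ^ 4 < D ^ 4 * (x * y * z) -> x <= M -> y <= M -> z <= M -> 0 < e ->
  r * M <= e * z -> N ^ 4 <= M -> e * D <= c * r * N -> False.
Proof.
move=> H xM yM zM e0 rz NM le.
have M0 : 0 < M.
  rewrite lt0n; apply/negP => /eqP e1; move: H; rewrite e1 in xM.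
  by rewrite (_ : x = 0) ?mul0n ?muln0 //; lia.
have e4 : 0 < e ^ 4 by rewrite expn_gt0 e0.
have h1 : (c * r) ^ 4 * M < (e * D) ^ 4.
  have M3 : 0 < M ^ 3 by rewrite expn_gt0 M0.
  rewrite -(ltn_pmul2r M3) -mulnA -expnS -expnMn.
  apply: leq_ltn_trans (_ : (e * (c * z)) ^ 4 < _).
    by apply: leq_expn_base; rewrite -mulnA [X in _ <= X]mulnCA leq_mul2l rz orbT.
  rewrite !(expnMn e) -mulnA ltn_pmul2l //; apply: leq_trans H _.
  rewrite leq_mul2l; apply/orP; right.
  by rewrite !expnS muln1 mulnA !leq_mul.
have : (c * r * N) ^ 4 < (e * D) ^ 4.
  by apply: leq_ltn_trans h1; rewrite expnMn leq_mul2l NM orbT.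
by rewrite ltn_exp2r // ltnNge le.
Qed.

Lemma consecutive_gcd n d f : 0 < n -> coprime n d ->
  gcdn (1 * ap n d f) (1 * ap n d (f + 2)) <= 2.
Proof.
move=> n0 nd; rewrite !mul1n; apply: dvdn_leq => //.
by have := gcdn_ap_dvd n0 nd (leq_addr 2 f); rewrite addKn.
Qed.

Lemma consecutive_three (R : realType) (abc : explicit_abc R) n d k f :
  0 < n -> 1 < d -> coprime n d -> powered n d k 8 -> f + 2 < k ->
  (forall i p, f <= i <= f + 2 -> prime p -> 3 < p <= k -> ~~ (p %| ap n d i)) ->
  (26 * ap n d f.+1) ^ 4 < 432 ^ 4 * (ap n d f * ap n d (f + 2) * ap n d f.+1).
Proof.
move=> n0 d1 nd pw fk nomid.
have f1 : f < k by lia. have f2 : f.+1 < k by lia.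
have E : 1 * ap n d f + 1 * ap n d (f + 2) = 2 * ap n d f.+1 by rewrite /ap; lia.
have g2 : 2 * 2 < 2 * ap n d f.+1 by rewrite /ap; nia.
apply: (three_term abc n0 nd pw f1 fk f2 _ _ _ E (consecutive_gcd f n0 nd) g2) => //.
by move=> p pp p3; rewrite !nomid //; lia.
Qed.

(** The constants just suffice: 26 * 2 * 25 = 1300 against 3 * 432 = 1296. *)
Lemma no_eighth_four (R : realType) (abc : explicit_abc R) n d :
  0 < n -> 1 < d -> coprime n d -> powered n d 4 8 -> False.
Proof.
move=> n0 d1 nd pw.
(* the least prime above 4 is 5, and 5^8 = 25^4 *)
have M5 : 25 ^ 4 <= ap n d 3.
  rewrite (_ : 25 = 5 ^ 2) // -expnM.
  exact: (last_term_ge R n0 d1 nd (leqnn 4) pw (fun p _ => id)).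
have H : (26 * ap n d 2) ^ 4 < 432 ^ 4 * (ap n d 1 * ap n d (1 + 2) * ap n d 2).
  apply: (consecutive_three abc n0 d1 nd pw) => // i p _ pp.
  by move: pp; case: p => [|[|[|[|[|p]]]]] //.
apply: (three_term_contra (e := 3) (r := 2) H _ (leqnn _) _ _ _ M5) => //.
- by rewrite /ap; lia.
- by rewrite /ap; lia.
- by rewrite /ap; lia.
Qed.

(** At most one of the five terms is a multiple of 5; three others are chosen
    according to its position. *)
Lemma no_eighth_five (R : realType) (abc : explicit_abc R) n d :
  0 < n -> 1 < d -> coprime n d -> powered n d 5 8 -> False.
Proof.
move=> n0 d1 nd pw.
have M7 : 49 ^ 4 <= ap n d 4.
  rewrite (_ : 49 = 7 ^ 2) // -expnM.
  apply: (last_term_ge R n0 d1 nd _ pw) => // p pp p5.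
  by rewrite leqNgt; apply/negP => p7; have e : p = 6 by [lia]; rewrite e in pp.
have five p : prime p -> 3 < p <= 5 -> p = 5.
  by clear; case: p => [|[|[|[|[|[|p]]]]]].
have uniq5 i j : i < j -> j < 5 -> 5 %| ap n d i -> ~~ (5 %| ap n d j).
  move=> ij j5 hi; apply/negP => hj.
  have c5 : coprime 5 d by rewrite prime_coprime // (ap_ndvd nd _ hi).
  have := dvdn_ap_sub (ltnW ij) c5 hi hj.
  by move/(dvdn_leq (_ : 0 < j - i)); rewrite subn_gt0 ij => /(_ isT); lia.
have cons f : f + 2 < 5 ->
   (forall i, f <= i <= f + 2 -> ~~ (5 %| ap n d i)) ->
   (26 * ap n d f.+1) ^ 4 < 432 ^ 4 * (ap n d f * ap n d (f + 2) * ap n d f.+1).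
  move=> f2 h; apply: (consecutive_three abc n0 d1 nd pw f2) => i p fi pp p3.
  by rewrite (five p pp p3); exact: h.
have [h2|h2] := boolP (5 %| ap n d 2).
  have n1 : ~~ (5 %| ap n d 1) by apply/negP => h; move: (uniq5 1 2 isT isT h); rewrite h2.
  have n3 := uniq5 2 3 isT isT h2; have n4 := uniq5 2 4 isT isT h2.
  have E : 1 * ap n d 1 + 2 * ap n d 4 = 3 * ap n d 3 by rewrite /ap; lia.
  have g6 : gcdn (1 * ap n d 1) (2 * ap n d 4) <= 6.
    apply: dvdn_leq => //; rewrite mul1n.
    apply: dvdn_trans (_ : 2 * gcdn (ap n d 1) (ap n d 4) %| _).
      by rewrite muln_gcdr dvdn_gcd dvdn_gcdr dvdn_mull ?dvdn_gcdl.
    by rewrite (_ : 6 = 2 * 3) // dvdn_pmul2l //; exact: (@gcdn_ap_dvd n d 1 4 n0 nd isT).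
  have g2 : 2 * 6 < 3 * ap n d 3 by rewrite /ap; lia.
  have H : (39 * ap n d 3) ^ 4 < (216 * 6) ^ 4 * (ap n d 1 * ap n d 4 * ap n d 3).
    apply: (three_term abc n0 nd pw _ _ _ _ _ _ E g6 g2) => // p pp p3.
    by rewrite (five p pp p3) n1 n3 n4.
  apply: (three_term_contra (e := 4) (r := 3) H _ (leqnn _) _ _ _ M7) => //.
  - by rewrite /ap; lia.
  - by rewrite /ap; lia.
  - by rewrite /ap; lia.
have [h3|h3] := boolP (5 %| ap n d 3).
  have nj i : i < 3 -> ~~ (5 %| ap n d i).
    by move=> i3; apply/negP => h; move: (uniq5 i 3 i3 isT h); rewrite h3.
  have H : (26 * ap n d 1) ^ 4 < 432 ^ 4 * (ap n d 0 * ap n d 2 * ap n d 1).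
    by apply: (cons 0) => // i /andP[_ i2]; apply: nj.
  (* T_2 >= M / 2, and 2 * 35^4 <= 49^4 *)
  have M35 : 35 ^ 4 <= ap n d 2.
    rewrite -(leq_pmul2l (isT : 0 < 2)); apply: leq_trans (_ : 49 ^ 4 <= _).
      have -> : 35 = 5 * 7 by [].
      have -> : 49 = 7 * 7 by [].
      rewrite !expnMn mulnA leq_mul2r; apply/orP; right.
      by have : 1250 <= 2401 by [].
    by apply: leq_trans M7 _; rewrite /ap; lia.
  apply: (three_term_contra (e := 2) (r := 1) H _ (leqnn _) _ _ _ M35) => //.
  - by rewrite /ap; lia.
  - by rewrite /ap; lia.
  - by rewrite /ap; lia.
have [h4|h4] := boolP (5 %| ap n d 4).
  have nj i : i < 4 -> ~~ (5 %| ap n d i).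
    by move=> i4; apply/negP => h; move: (uniq5 i 4 i4 isT h); rewrite h4.
  have H : (26 * ap n d 2) ^ 4 < 432 ^ 4 * (ap n d 1 * ap n d 3 * ap n d 2).
    by apply: (cons 1) => // i /andP[_ i2]; apply: nj.
  apply: (three_term_contra (e := 2) (r := 1) H _ _ _ _ _ M7) => //.
  - by rewrite /ap; lia.
  - by rewrite /ap; lia.
  - by rewrite /ap; lia.
  - by rewrite /ap; lia.
have H : (26 * ap n d 3) ^ 4 < 432 ^ 4 * (ap n d 2 * ap n d 4 * ap n d 3).
  apply: (cons 2) => // i /andP[i2 i4].
  by have [->|[->|->]] : i = 2 \/ i = 3 \/ i = 4 by lia.
apply: (three_term_contra (e := 4) (r := 3) H _ (leqnn _) _ _ _ M7) => //.
- by rewrite /ap; lia.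
- by rewrite /ap; lia.
- by rewrite /ap; lia.
Qed.

(** * Conclusion *)

Lemma numeric_eight (R : realType) (x la : R) : (7 / 2 <= la -> 64 * 2 <= x ->
  (x - 6) * (17 - 4) * la <= 23 / 2 * x * la + 28 * la + 6 / 5 * x + 40 -> False)%R.
Proof.
move=> l7 x128; have : (0 <= (x - 64 * 2) * (la - 7 / 2))%R by apply: mulr_ge0; lra.
lra.
Qed.

Lemma numeric_seven (R : realType) (x la : R) : (100 <= la -> 64 * 16 <= x ->
  (x - 6) * (63 / 4 - 4) * la <= 23 / 2 * x * la + 28 * la + 6 / 5 * x + 40 -> False)%R.
Proof.
move=> l7 x1024; have : (0 <= (x - 64 * 16) * (la - 100))%R by apply: mulr_ge0; lra.
lra.
Qed.

(** With 4^5 <= 11^3 the primes above k cost p^(18/5), and (k+1)^(88/5)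
    remains on the left of window_inequality; the exponent 17 is used. *)
Lemma no_eighth_large (R : realType) (abc : explicit_abc R) n d k :
  0 < n -> 1 < d -> coprime n d -> 7 <= k -> powered n d k 8 -> False.
Proof.
move=> n0 d1 nd k7 pw.
have k4 : 4 <= k by lia.
have Mk : k.+1 ^ 8 <= ap n d k.-1 := last_term_ge R n0 d1 nd k4 pw (fun p _ kp => kp).
have c45 p : prime p -> k < p -> 4 ^ 5 <= p ^ 3.
  move=> pp kp; apply: leq_trans (_ : 11 ^ 3 <= _); first by [].
  rewrite leq_exp2r // leqNgt; apply/negP => p11.
  have [e|[e|e]] : p = 8 \/ p = 9 \/ p = 10 by lia.
  - by rewrite e in pp.
  - by rewrite e in pp.
  - by rewrite e in pp.
have := @windows_product R abc n d k 8 5 3 17 1 n0 d1 nd k7 pw isT c45 Mk isT isT isT.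
have [k128|k128] := ltnP k 128.
  have kk : 7 <= k < 128 by rewrite k7.
  by rewrite muln1 expn1 ltnNge (window_finite kk).
move=> H; have {H} := @window_log_bound R k 17 1 k128 isT H.
have ln72 : (7 / 2 <= ln (k%:R : R))%R.
  have := ler_ln_nat R (isT : 0 < 2 ^ 7)%N (k128 : 2 ^ 7 <= k).
  by rewrite lnX_nat //; have := ln2_ge R; lra.
have kr : (64 * 2 <= k%:R :> R)%R by rewrite -natrM ler_nat.
rewrite divr1; set la := ln _ in ln72 *; set x : R := k%:R%R in kr *.
exact: numeric_eight ln72 kr.
Qed.

Lemma no_eighth_power (R : realType) (abc : explicit_abc R) n d k :
  0 < n -> 1 < d -> coprime n d -> 4 <= k -> powered n d k 8 -> False.
Proof.
move=> n0 d1 nd k4 pw.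
have [k7|k7] := leqP 7 k; first exact: (no_eighth_large abc n0 d1 nd k7 pw).
have [e|[e|e]] : k = 4 \/ k = 5 \/ k = 6 by lia.
- by rewrite e in pw; exact: (no_eighth_four abc n0 d1 nd pw).
- by rewrite e in pw; exact: (no_eighth_five abc n0 d1 nd pw).
apply: (no_eighth_five abc n0 d1 nd) => i p i5 pp p5; apply: pw => //; first by lia.
by rewrite e ltn_neqAle p5 andbT; apply: contraTneq pp => <-.
Qed.

(** The primes above k cost p^(151/50), which leaves the exponent
    63/4 > 31/2. *)
Lemma no_seventh_power_huge (R : realType) (abc : explicit_abc R) n d k :
  0 < n -> 1 < d -> coprime n d -> 4 <= k -> powered n d k 7 ->
  (100 <= ln (k%:R : R))%R -> False.
Proof.
move=> n0 d1 nd k4 pw lnk.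
have [N eN] : exists N, N = 100 by exists 100.
have k2 : 2 ^ N <= k.
  rewrite leqNgt; apply/negP => klt.
  have k0 : 0 < k by apply: leq_trans k4.
  have := ler_ln_nat R k0 (ltnW klt); rewrite lnX_nat ?eN //.
  by have := ln2_le R; move: lnk; set la := ln _; set L := ln 2; clearbody la L; clear; lra.
have k1024 : 2 ^ 10 <= k by apply: leq_trans k2; rewrite leq_exp2l // eN.
have k128 : 128 <= k by apply: leq_trans k1024.
have k7 : 7 <= k by apply: leq_trans k128.
have Mk : k.+1 ^ 7 <= ap n d k.-1 := last_term_ge R n0 d1 nd k4 pw (fun p _ kp => kp).
have c450 p : prime p -> k < p -> 4 ^ 50 <= p ^ 1.
  move=> _ kp; rewrite expn1; apply: leq_trans (ltnW kp); apply: leq_trans k2.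
  by rewrite (_ : 4 ^ 50 = 2 ^ N) // (_ : N = 2 * 50) ?expnM.
have := @windows_product R abc n d k 7 50 1 63 4 n0 d1 nd k7 pw isT c450 Mk isT.
move=> /(_ isT isT) H; have {H} := @window_log_bound R k 63 4 k128 isT H.
have kr : (64 * 16 <= k%:R :> R)%R by rewrite -natrM ler_nat.
set la := ln _ in lnk *; set x : R := k%:R%R in kr *.
exact: numeric_seven lnk kr.
Qed.

Local Open Scope ring_scope.

Theorem theorem2 (R : realType) (abc : explicit_abc R)
  (n d k b y l : nat)
  (hn : (1 <= n)%N) (hd : (1 < d)%N) (hk : (4 <= k)%N)
  (hb : (1 <= b)%N) (hy : (1 <= y)%N) (hl : (1 < l)%N)
  (hnd : coprime n d) (hPb : (max_pdiv b <= k)%N)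
  (heq : (\prod_(0 <= i < k) (n + i * d) = b * y ^ l)%N) :
  (l <= 7)%N /\ (l = 7%N -> k%:R < expR (13006 + 2 / 10 : R)).
Proof.
have pw : powered n d k l := powered_of_product hn hnd hb hy hPb heq.
split.
  rewrite leqNgt; apply/negP => l8.
  exact: (no_eighth_power abc hn hd hnd hk (powered_leq l8 pw)).
move=> l7; rewrite ltNge; apply/negP => kbig.
apply: (no_seventh_power_huge abc hn hd hnd hk); first by rewrite -l7.
apply: le_trans (_ : ln (expR (13006 + 2 / 10)) <= _).
  by rewrite expRK -[100]addr0 lerD // ?divr_ge0 // ler_nat.
by rewrite ler_ln ?posrE ?expR_gt0 // ltr0n; apply: leq_trans hk.
Qed.
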